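(* Let $\Phi=\{\varphi_\nu\}_{\nu=1}^\infty\subset\mathcal A(\mathbb R^n)$ be a family satisfying the following conditions: (i$_0$) for each $\nu\in\mathbb N$ and each $A>0$ there is a constant $C_{\nu,A}>0$ such that $\varphi_\nu(x)+A\ln(1+\|x\|)\le\varphi_{\nu+1}(x)+C_{\nu,A}$ for all $x\in\mathbb R^n$; (i$_1$) for each $\nu\in\mathbb N$ there exist constants $\sigma_\nu>1$ and $\gamma_\nu>0$ such that $\varphi_\nu(\sigma_\nu x)\le\varphi_{\nu+1}(x)+\gamma_\nu$ for all $x\in\mathbb R^n$; (i$_2$) for each $\nu\in\mathbb N$ there exists a constant $K_\nu>0$ such that $\varphi_\nu(x+\xi)\le\varphi_{\nu+1}(x)+K_\nu$ for all $x\in[0,\infty)^n$, $\xi\in[0,1]^n$. Then $E(\Phi)=\mathcal H(\Phi)$ as topological vector spaces.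
   Context: Let $n\in\mathbb N$; $\mathbb Z_+=\{0,1,2,\dots\}$; $\|\cdot\|$ is the Euclidean norm on $\mathbb R^n$ and $\mathbb C^n$; $\langle u,v\rangle=u_1v_1+\cdots+u_nv_n$; for $z\in\mathbb C^n$, $\operatorname{Im}z=(\operatorname{Im}z_1,\dots,\operatorname{Im}z_n)$; $H(\mathbb C^n)$ is the space of entire functions on $\mathbb C^n$. $\mathcal A(\mathbb R^n)$ is the set of all real-valued $g\in C(\mathbb R^n)$ such that: 1) $g(x)=g(|x_1|,\dots,|x_n|)$ for all $x\in\mathbb R^n$; 2) the restriction of $g$ to $[0,\infty)^n$ is nondecreasing in each variable; 3) $\lim_{x\to\infty}g(x)/\|x\|=+\infty$. For $g:\mathbb R^n\to[-\infty,+\infty]$ the Young-Fenchel conjugate is $g^*(x)=\sup_{y\in\mathbb R^n}(\langle x,y\rangle-g(y))$, $x\in\mathbb R^n$. Put $\psi_\nu(x)=\varphi_\nu(e^{x_1},\dots,e^{x_n})$ for $x\in\mathbb R^n$. $E(\varphi_\nu)$ is the space of all $f\in H(\mathbb C^n)$ such that for every $m\in\mathbb Z_+$ $$p_{\nu,m}(f)=\sup_{z\in\mathbb C^n}\frac{|f(z)|(1+\|z\|)^m}{e^{\varphi_\nu(\operatorname{Im}z)}}<\infty,$$ with the topology defined by the norms $p_{\nu,m}$, $m\in\mathbb Z_+$. $E(\Phi)=\bigcup_{\nu\ge1}E(\varphi_\nu)$ is equipped with the (locally convex) inductive limit topology of the spaces $E(\varphi_\nu)$. $\mathcal H(\varphi_\nu)$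 is the space of all $f\in H(\mathbb C^n)$ such that for every $m\in\mathbb Z_+$ $$\sigma_{\nu,m}(f)=\sup_{z\in\mathbb C^n}\frac{|f(z)|(1+\|z\|)^m}{e^{(\psi_\nu^* )^*(\ln(1+|\operatorname{Im}z_1|),\dots,\ln(1+|\operatorname{Im}z_n|))}}<\infty,$$ with the topology defined by the norms $\sigma_{\nu,m}$, $m\in\mathbb Z_+$. $\mathcal H(\Phi)=\bigcup_{\nu\ge1}\mathcal H(\varphi_\nu)$ is equipped with the (locally convex) inductive limit topology of the spaces $\mathcal H(\varphi_\nu)$. *)

(* Defs.v *)
(* MathComp-Analysis; the complex numbers are R[i] for R : realType. *)
From mathcomp Require Import all_boot all_order all_algebra complex.
From mathcomp Require Import all_classical all_reals all_analysis.

Set Implicit Arguments.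
Unset Strict Implicit.
Unset Printing Implicit Defensive.

Import Order.TTheory GRing.Theory Num.Theory.
Import numFieldNormedType.Exports.

Local Open Scope classical_set_scope.
Local Open Scope ring_scope.

Section RealSide.
Context {R : realType} {n : nat}.
Implicit Types (x y : 'rV[R]_n) (g : 'rV[R]_n -> R).

(* The library norm on row vectors is the sup norm. *)
Definition enorm x : R := Num.sqrt (\sum_j x 0 j ^+ 2).

Definition dotv x y : R := \sum_j x 0 j * y 0 j.

Definition orthant : set 'rV[R]_n := [set x | forall j, 0 <= x 0 j].

Definition unit_cube : set 'rV[R]_n := [set x | forall j, 0 <= x 0 j <= 1].

Definition nondecreasing_each g : Prop :=
  forall x y j, orthant x -> orthant y ->
    (forall k, k != j -> x 0 k = y 0 k) -> x 0 j <= y 0 j -> g x <= g y.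

Definition classA : set ('rV[R]_n -> R) :=
  [set g | [/\ continuous g,
               forall x, g x = g (map_mx Num.norm x),
               nondecreasing_each g &
               forall M : R, exists r : R,
                 forall x, r < enorm x -> M < g x / enorm x]].

Definition young_fenchel (G : 'rV[R]_n -> \bar R) (x : 'rV[R]_n) : \bar R :=
  ereal_sup [set ((dotv x y)%:E - G y)%E | y in [set: 'rV[R]_n]].

Definition psi g (x : 'rV[R]_n) : R := g (map_mx expR x).

(* psi^* takes the value +oo, and so biconjugation is done in \bar R. *)
Definition psi_biconj g : 'rV[R]_n -> \bar R :=
  young_fenchel (young_fenchel (fun x => (psi g x)%:E)).

End RealSide.

Section EntireFunctions.
Context {R : realType} {n : nat}.
Local Notation Cn := 'rV[R[i]]_n.
(* R[i]^o carries the R[i]-module structure, so that functions into it form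
   an lmodType over R[i] under pointwise operations. *)
Local Notation fct := (Cn -> R[i]^o).

Definition cmod (c : R[i]) : R := complex.Re `|c|.

Definition cnorm (z : Cn) : R := Num.sqrt (\sum_j cmod (z 0 j) ^+ 2).

Definition imv (z : Cn) : 'rV[R]_n := map_mx (@complex.Im R) z.

(* Frechet differentiability over the field R[i], i.e. the differential is
   complex linear. *)
Definition entire : set fct := [set f | forall z, differentiable f z].

Definition wnorm (w : Cn -> \bar R) (m : nat) (f : fct) : \bar R :=
  ereal_sup [set ((cmod (f z) * (1 + cnorm z) ^+ m)%:E / expeR (w z))%E
            | z in [set: Cn]].

Definition wspace (w : Cn -> \bar R) : set fct :=
  [set f | entire f /\ forall m, (wnorm w m f < +oo)%E].

(* Neighbourhoods of 0 in wspace w for the topology of the norms wnorm w m. *)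
Definition wspace_nbhs0 (w : Cn -> \bar R) : set_system fct :=
  [set V | exists (M : nat) (e : R), 0 < e /\
     forall f, wspace w f ->
       (forall m, (m <= M)%N -> (wnorm w m f < e%:E)%E) -> V f].

Definition absolutely_convex (V : set fct) : Prop :=
  forall (a b : R[i]) f g, cmod a + cmod b <= 1 -> V f -> V g ->
    V (a *: f + b *: g).

Definition indlim (W : nat -> Cn -> \bar R) : set fct :=
  \bigcup_nu wspace (W nu).

(* Open sets of the finest locally convex topology on indlim W for which all
   inclusions of the spaces wspace (W nu) are continuous: a base of
   neighbourhoods of 0 is given by the absolutely convex sets whose trace on
   each step is a neighbourhood of 0 there. *)
Definition indlim_open (W : nat -> Cn -> \bar R) : set_system fct :=
  [set U | U `<=` indlim W /\
     forall f, U f -> exists V : set fct,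
       [/\ V `<=` indlim W,
           absolutely_convex V,
           forall nu, wspace_nbhs0 (W nu) V &
           forall v, V v -> U (f + v)]].

Definition weightE (g : 'rV[R]_n -> R) (z : Cn) : \bar R := (g (imv z))%:E.

Definition weightH (g : 'rV[R]_n -> R) (z : Cn) : \bar R :=
  psi_biconj g (map_mx (fun t => ln (1 + `|t|)) (imv z)).

Definition E_Phi (phi : nat -> 'rV[R]_n -> R) : set fct :=
  indlim (fun nu => weightE (phi nu)).

Definition E_Phi_open (phi : nat -> 'rV[R]_n -> R) : set_system fct :=
  indlim_open (fun nu => weightE (phi nu)).

Definition H_Phi (phi : nat -> 'rV[R]_n -> R) : set fct :=
  indlim (fun nu => weightH (phi nu)).

Definition H_Phi_open (phi : nat -> 'rV[R]_n -> R) : set_system fct :=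
  indlim_open (fun nu => weightH (phi nu)).

End EntireFunctions.

(* Main.v *)
Require Import Defs.
From mathcomp Require Import all_boot all_order all_algebra complex.
From mathcomp Require Import all_classical all_reals all_analysis.
From mathcomp Require Import ring lra.
Import Order.TTheory GRing.Theory Num.Theory.
Import numFieldNormedType.Exports.
Local Open Scope classical_set_scope.
Local Open Scope ring_scope.
Set Implicit Arguments.
Unset Strict Implicit.
Unset Printing Implicit Defensive.

(** The inclusion of the step of weight psi** in the step of weight phi is
    elementary: psi** <= psi, and replacing |y| by 1 + |y| costs a constant
    ([weightH_dominates_weightE]).

    The converse rests on a convexity property. If F is holomorphic on C^n and
    |F(w)| <= exp (psi (Re w)), then s |-> ln sup over Re w = s of |F(w)| is
    convex, by the three lines theorem on complex lines with real direction.
    A convex function below psi is below the biconjugate psi**, by existence of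
    subgradients. Thus |F(w)| <= exp (psi** (Re w)) ([affine_minorant]). For f
    in a step of weight phi this is applied to F(w) = f(x + exp w), where x is a
    real point: the imaginary part of x + exp w is bounded coordinatewise by
    exp (Re w), so F satisfies the hypothesis with psi(s) = phi(exp s). A given
    z with imaginary part y is reached with Re w_j = ln (1 + |y_j|) by choosing
    the centre x with |z_j - x_j| = 1 + |y_j|, which is exactly the point where
    the weight of the space H evaluates psi**. Polynomial factors are carried by
    the centre x and by an extra factor exp (m sum w_j), and absorbed by the
    growth condition between consecutive functions of the family
    ([weightE_dominates_weightH]).

    The three lines theorem is derived from first principles. Goursat's
    bisection argument is carried out for real one-forms p dx + q dy with equal
    mixed derivatives at each point ([goursat]). Applied to the imaginary part
    of the Cauchy kernel form (g - g(0)) dz / z, it gives a bound of |g(0)| by a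
    constant times the maximum of |g| on the boundary of a rectangle, and
    applying this bound to powers of g turns the constant into 1
    ([maximum_principle]).

    Both comparisons of weights dominate seminorms one by one with the index of
    the step raised by one, so the unions and the inductive topologies agree
    ([indlim_sub], [indlim_open_sub]). *)

Local Notation "x +I y" := (Complex x y) (at level 50).

(** * Goursat's lemma for closed one-forms on rectangles *)

Section ClosedForms.
Context {R : realType}.
Implicit Types (u v : R -> R) (p q : R -> R -> R).

Definition segint (a b : R) u : R := \int[lebesgue_measure]_(x in `[a, b]) u x.

Lemma segint_integrable (a b : R) u : continuous u ->
  (@lebesgue_measure R).-integrable `[a, b] (EFin \o u).
Proof.
move=> cu; apply: continuous_compact_integrable; first exact: segment_compact.
by apply: continuous_subspaceT.
Qed.

Lemma segint_split (a b m : R) u : continuous u -> a <= m <= b ->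
  segint a b u = segint a m u + segint m b u.
Proof.
move=> cu /andP[am mb]; rewrite /segint.
have := @Rintegral_itvB R u (BLeft a) (BRight b) m (segint_integrable a b cu).
rewrite !bnd_simp => /(_ am mb) h.
rewrite -(@Rintegral_itv_obnd_cbnd _ m); last first.
  apply: integrableS (segint_integrable m b cu) => //.
  by apply: subset_itvr; rewrite bnd_simp.
by rewrite -h; ring.
Qed.

Lemma segintD (a b : R) u v : continuous u -> continuous v ->
  segint a b (fun x => u x + v x) = segint a b u + segint a b v.
Proof. by move=> cu cv; apply: RintegralD => //; apply: segint_integrable. Qed.

Lemma segint_cst (a b r : R) : a <= b -> segint a b (fun=> r) = r * (b - a).
Proof.
move=> ab; rewrite /segint Rintegral_cst//= lebesgue_measure_itv/= lte_fin.
case: ltrP => // ba; have -> : a = b by apply/le_anti/andP.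
by rewrite subrr.
Qed.

Lemma segint_ub (a b r : R) u : continuous u -> a <= b ->
  (forall x, a <= x <= b -> u x <= r) -> segint a b u <= r * (b - a).
Proof.
move=> cu ab ur; rewrite -segint_cst//; apply: le_Rintegral; first by [].
- exact: segint_integrable.
- by apply: segint_integrable => x; apply: cvg_cst.
by move=> x; rewrite /= in_itv; apply: ur.
Qed.

Lemma segint_lb (a b r : R) u : continuous u -> a <= b ->
  (forall x, a <= x <= b -> r <= u x) -> r * (b - a) <= segint a b u.
Proof.
move=> cu ab ur; rewrite -segint_cst//; apply: le_Rintegral; first by [].
- by apply: segint_integrable => x; apply: cvg_cst.
- exact: segint_integrable.
by move=> x; rewrite /= in_itv; apply: ur.
Qed.

(** The integral of the one-form p dx + q dy along the positively oriented
    boundary of [[a, b] x [c, d]]. Opposite sides are paired under one integral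
    sign, so that only differences of values on opposite sides have to be
    estimated. *)
Definition circulation p q (a b c d : R) : R :=
  segint a b (fun x => p x c - p x d) + segint c d (fun y => q b y - q a y).

Definition sep_continuous p q : Prop :=
  (forall y, continuous (p^~ y)) /\ (forall x, continuous (q x)).

Lemma circulation_splitx p q (a b c d m : R) : sep_continuous p q -> a <= m <= b ->
  circulation p q a b c d = circulation p q a m c d + circulation p q m b c d.
Proof.
move=> [cp cq] amb; rewrite /circulation (segint_split _ amb); last first.
  by move=> x; apply: cvgB; [exact: cp|exact: cp].
have -> : (fun y => q b y - q a y) =
    (fun y => (q b y - q m y) + (q m y - q a y)) by apply/funext => y; ring.
rewrite (@segintD c d (fun y => q b y - q m y) (fun y => q m y - q a y)); first by ring.
  by move=> x; apply: cvgB; exact: cq.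
by move=> x; apply: cvgB; exact: cq.
Qed.

Lemma circulation_splity p q (a b c d m : R) : sep_continuous p q -> c <= m <= d ->
  circulation p q a b c d = circulation p q a b c m + circulation p q a b m d.
Proof.
move=> [cp cq] cmd; rewrite /circulation (@segint_split c d m) //; last first.
  by move=> x; apply: cvgB; [exact: cq|exact: cq].
have -> : (fun x => p x c - p x d) =
    (fun x => (p x c - p x m) + (p x m - p x d)) by apply/funext => y; ring.
rewrite (@segintD a b (fun x => p x c - p x m) (fun x => p x m - p x d)); first by ring.
  by move=> x; apply: cvgB; exact: cp.
by move=> x; apply: cvgB; exact: cp.
Qed.

(** Differentiability of the pair (p, q) at a point with symmetric mixed
    derivatives: the common coefficient [p2] is both the y-derivative of p and
    the x-derivative of q. For p = Im g, q = Re g these are the Cauchy-Riemann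
    equations. No continuity of the derivatives is asked, as complex
    differentiability at every point does not supply it directly. *)
Definition closed_at p q (x0 y0 : R) : Prop := exists p1 p2 q2 : R,
  forall e, 0 < e -> exists2 r, 0 < r & forall x y,
    `|x - x0| <= r -> `|y - y0| <= r ->
    `|p x y - p x0 y0 - p1 * (x - x0) - p2 * (y - y0)|
       <= e * (`|x - x0| + `|y - y0|) /\
    `|q x y - q x0 y0 - p2 * (x - x0) - q2 * (y - y0)|
       <= e * (`|x - x0| + `|y - y0|).

(** The affine parts of p and q contribute opposite amounts because the mixed
    derivatives agree; what remains is the first-order error times the
    perimeter, i.e. o(side ^ 2). *)
Lemma circulation_small p q (x0 y0 : R) : sep_continuous p q -> closed_at p q x0 y0 ->
  forall e, 0 < e -> exists2 r, 0 < r & forall a b c d : R,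
    a <= x0 <= b -> c <= y0 <= d -> b - a <= r -> d - c <= r ->
    `|circulation p q a b c d| <= e * ((b - a) + (d - c)) ^+ 2.
Proof.
move=> [cp cq] [p1 [p2 [q2 H]]] e e0.
have [|r r0 Hr] := H (e / 2); first lra.
exists r => // a b c d /andP[ax xb] /andP[cy yd] bar dcr.
pose S := (b - a) + (d - c).
have near x y : a <= x <= b -> c <= y <= d -> [/\ `|x - x0| <= r, `|y - y0| <= r &
    `|x - x0| + `|y - y0| <= S].
  move=> /andP[ax' xb'] /andP[cy' yd'].
  have h1 : `|x - x0| <= b - a by rewrite ler_norml; apply/andP; split; lra.
  have h2 : `|y - y0| <= d - c by rewrite ler_norml; apply/andP; split; lra.
  by rewrite /S; split; lra.
have S0 : 0 <= S by rewrite /S; lra.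
have ab : a <= b by lra.
have cd : c <= d by lra.
have Hp x y : a <= x <= b -> c <= y <= d ->
   `|p x y - p x0 y0 - p1 * (x - x0) - p2 * (y - y0)| <= e / 2 * S /\
   `|q x y - q x0 y0 - p2 * (x - x0) - q2 * (y - y0)| <= e / 2 * S.
  move=> hx hy; have [h1 h2 h3] := near x y hx hy.
  have [A B] := Hr x y h1 h2.
  have : e / 2 * (`|x - x0| + `|y - y0|) <= e / 2 * S by rewrite ler_wpM2l//; lra.
  by move=> le; split; [apply: le_trans A le|apply: le_trans B le].
have dp x : a <= x <= b ->
    (- p2 * (d - c) - e * S <= p x c - p x d <= - p2 * (d - c) + e * S).
  move=> hx; have [|A _] := Hp x c hx; first lra.
  have [|B _] := Hp x d hx; first lra.
  move: A B; rewrite !ler_norml => /andP[A1 A2] /andP[B1 B2].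
  by apply/andP; split; lra.
have dq y : c <= y <= d ->
    (p2 * (b - a) - e * S <= q b y - q a y <= p2 * (b - a) + e * S).
  move=> hy; have [|_ A] := Hp a y _ hy; first lra.
  have [|_ B] := Hp b y _ hy; first lra.
  move: A B; rewrite !ler_norml => /andP[A1 A2] /andP[B1 B2].
  by apply/andP; split; lra.
have cp' : continuous (fun x => p x c - p x d).
  by move=> x; apply: cvgB; exact: cp.
have cq' : continuous (fun x => q b x - q a x).
  by move=> x; apply: cvgB; exact: cq.
have u1 := segint_ub cp' ab (fun x hx => proj2 (andP (dp x hx))).
have l1 := segint_lb cp' ab (fun x hx => proj1 (andP (dp x hx))).
have u2 := segint_ub cq' cd (fun x hx => proj2 (andP (dq x hx))).
have l2 := segint_lb cq' cd (fun x hx => proj1 (andP (dq x hx))).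
rewrite -/S /circulation expr2 ler_norml.
have -> : e * (S * S) = e * S * (b - a) + e * S * (d - c) by rewrite /S; ring.
by apply/andP; split; nra.
Qed.

Definition quarter p q (s t : R * R * R * R) : Prop :=
  let: (a, b, c, d) := s in let: (a', b', c', d') := t in
  a <= b -> c <= d ->
  [/\ a <= a' /\ b' <= b, c <= c' /\ d' <= d, b' - a' = (b - a) / 2,
      d' - c' = (d - c) / 2 &
      `|circulation p q a b c d| <= 4 * `|circulation p q a' b' c' d'|].

(** The circulation of a rectangle is the sum of those of its four quarters,
    so one quarter carries at least a fourth of it. *)
Lemma quarter_exists p q : sep_continuous p q ->
  forall s, exists t, quarter p q s t.
Proof.
move=> cpq [[[a b] c] d].
have [/andP[ab cd]|/negP h] := boolP ((a <= b) && (c <= d)); last first.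
  by exists (a, b, c, d) => ab cd; case: h; rewrite ab cd.
pose m := (a + b) / 2; pose k := (c + d) / 2.
have hm : a <= m <= b by rewrite /m; apply/andP; split; lra.
have hk : c <= k <= d by rewrite /k; apply/andP; split; lra.
have E : circulation p q a b c d = circulation p q a m c k + circulation p q a m k d
   + (circulation p q m b c k + circulation p q m b k d).
  by rewrite (circulation_splitx _ _ cpq hm) !(circulation_splity _ _ cpq hk).
have Q (a' b' c' d' : R) : (a', b') = (a, m) \/ (a', b') = (m, b) ->
   (c', d') = (c, k) \/ (c', d') = (k, d) ->
   `|circulation p q a b c d| <= 4 * `|circulation p q a' b' c' d'| ->
   quarter p q (a, b, c, d) (a', b', c', d').
  move: hm hk; rewrite /m /k => /andP[? ?] /andP[? ?] [] [-> ->] [] [-> ->] h _ _;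
  by split => //; lra.
have tri : `|circulation p q a b c d| <= `|circulation p q a m c k| + `|circulation p q a m k d|
   + (`|circulation p q m b c k| + `|circulation p q m b k d|).
  rewrite E; apply: (le_trans (ler_normD _ _)).
  by apply: lerD; apply: ler_normD.
have [h1|h1] := lerP `|circulation p q a b c d| (4 * `|circulation p q a m c k|).
  by exists (a, m, c, k); apply: Q => //; left.
have [h2|h2] := lerP `|circulation p q a b c d| (4 * `|circulation p q a m k d|).
  by exists (a, m, k, d); apply: Q => //; [left|right].
have [h3|h3] := lerP `|circulation p q a b c d| (4 * `|circulation p q m b c k|).
  by exists (m, b, c, k); apply: Q => //; [right|left].
exists (m, b, k, d); apply: Q; [by right|by right|].
by move: tri h1 h2 h3; clear; lra.
Qed.

Lemma nested_point (a b : nat -> R) :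
  (forall k, a k <= a k.+1) -> (forall k, b k.+1 <= b k) ->
  (forall k, a k <= b k) -> exists x, forall k, a k <= x <= b k.
Proof.
move=> ha hb hab.
have am : {homo a : i j / (i <= j)%N >-> i <= j}.
  by apply: homo_leq => //; exact: le_trans.
have bm : {homo b : i j / (i <= j)%N >-> j <= i}.
  by apply: (@homo_leq _ _ (fun x y => y <= x)) => // x y z h1 h2; apply: le_trans h2 h1.
have ajb i j : a i <= b j.
  apply: le_trans (am _ _ (leq_maxl i j)) _.
  by apply: le_trans (hab _) (bm _ _ (leq_maxr i j)).
have hs : has_sup (range a).
  split; first by exists (a 0%N); exists 0%N.
  by exists (b 0%N) => _ [k _ <-].
exists (sup (range a)) => k; apply/andP; split.
  by apply: ub_le_sup; [exact: (proj2 hs)|exists k].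
by apply: ge_sup => [|_ [j _ <-]]; [exact: (proj1 hs)|].
Qed.

(** Bisect: nested quarters shrink to a point and keep at least [4 ^- k] of the
    circulation, whereas near that point the circulation of a rectangle of side
    of order [2 ^- k] is [o(4 ^- k)]. *)
Theorem goursat p q (a b c d : R) : sep_continuous p q -> a <= b -> c <= d ->
  (forall x y, a <= x <= b -> c <= y <= d -> closed_at p q x y) ->
  circulation p q a b c d = 0.
Proof.
move=> cpq ab cd cl; apply/eqP; rewrite -normr_eq0 -[_ == _]negbK.
apply/negP => /eqP K0.
have [nxt Hn] := choice (quarter_exists cpq).
pose t k := iter k nxt (a, b, c, d).
pose A k := (t k).1.1.1; pose B k := (t k).1.1.2; pose C k := (t k).1.2.
pose D k := (t k).2.
have tE k : t k = (A k, B k, C k, D k) by rewrite /A /B /C /D; case: (t k) => [[[]]].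
have Q k : quarter p q (A k, B k, C k, D k) (A k.+1, B k.+1, C k.+1, D k.+1).
  by rewrite -!tE; apply: Hn.
have ABk k : B k - A k = (b - a) / 2 ^+ k /\ D k - C k = (d - c) / 2 ^+ k.
  elim: k => [|k [IH1 IH2]]; first by rewrite expr0 !divr1.
  have p2 : (0 : R) <= 2 ^- k by rewrite invr_ge0 exprn_ge0.
  have [||_ _ -> -> _] := Q k.
  - by rewrite -subr_ge0 IH1 mulr_ge0 // subr_ge0.
  - by rewrite -subr_ge0 IH2 mulr_ge0 // subr_ge0.
  by rewrite IH1 IH2 exprSr invfM; split; ring.
have p2 k : (0 : R) <= 2 ^- k by rewrite invr_ge0 exprn_ge0.
have AB k : A k <= B k.
  by rewrite -subr_ge0 (proj1 (ABk k)) mulr_ge0// subr_ge0.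
have CD k : C k <= D k.
  by rewrite -subr_ge0 (proj2 (ABk k)) mulr_ge0// subr_ge0.
have [X HX] : exists x, forall k, A k <= x <= B k.
  by apply: nested_point => // k; have [[]] := Q k (AB k) (CD k).
have [Y HY] : exists x, forall k, C k <= x <= D k.
  by apply: nested_point => // k; have [_ []] := Q k (AB k) (CD k).
have HK k : `|circulation p q a b c d| <= 4 ^+ k * `|circulation p q (A k) (B k) (C k) (D k)|.
  elim: k => [|k IH]; first by rewrite expr0 mul1r.
  have [_ _ _ _ h] := Q k (AB k) (CD k).
  apply: le_trans IH _; rewrite exprSr -mulrA; exact: ler_wpM2l.
pose S := (b - a) + (d - c); have S0 : 0 <= S by rewrite /S; lra.
pose K := `|circulation p q a b c d|.
have Kp : 0 < K by rewrite lt_def normr_ge0 andbT; apply/eqP.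
have [|r r0 Hr] := circulation_small cpq (cl X Y (HX 0%N) (HY 0%N)) (e := K / (2 * (S ^+ 2 + 1))).
  by rewrite divr_gt0// mulr_gt0// ltr_wpDl// sqr_ge0.
have [k Hk] : exists k : nat, S <= r * 2 ^+ k.
  exists (Num.truncn (S / r)).+1; rewrite -ler_pdivrMl// mulrC.
  have h : S / r <= (Num.truncn (S / r)).+1%:R.
    by rewrite ltW// truncnS_gt.
  apply: le_trans h _; rewrite -natrX ler_nat; apply/ltnW; exact: ltn_expl.
have p2' : (0 : R) < 2 ^+ k by rewrite exprn_gt0.
have HS : S / 2 ^+ k <= r by rewrite ler_pdivrMr.
have := Hr _ _ _ _ (HX k) (HY k).
rewrite (proj1 (ABk k)) (proj2 (ABk k)) -mulrDl -/S.
have l1 : (b - a) / 2 ^+ k <= r.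
  by apply: le_trans HS; rewrite ler_pM2r ?invr_gt0// /S; lra.
have l2 : (d - c) / 2 ^+ k <= r.
  by apply: le_trans HS; rewrite ler_pM2r ?invr_gt0// /S; lra.
move=> /(_ l1 l2) h.
have := le_trans (HK k) (ler_wpM2l (exprn_ge0 k (ler0n R 4)) h).
have -> : (4 : R) ^+ k = (2 ^+ k) ^+ 2 by rewrite exprAC expr2; congr (_ ^+ _); ring.
rewrite -/K exprMn exprVn.
have -> : (2 ^+ k) ^+ 2 * (K / (2 * (S ^+ 2 + 1)) * (S ^+ 2 * ((2 ^+ k) ^+ 2)^-1))
  = (K * S ^+ 2) / (2 * (S ^+ 2 + 1)).
  by field; rewrite !gt_eqF// ltr_wpDl// sqr_ge0.
have S20 : 0 <= S ^+ 2 by rewrite sqr_ge0.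
rewrite ler_pdivlMr; last by rewrite mulr_gt0// ltr_wpDl.
by nra.
Qed.

End ClosedForms.

(** * Moduli and complex differentiability *)

Section ComplexModulus.
Context {R : realType}.
Implicit Types (z w : R[i]).

Lemma cmodE z : cmod z = Num.sqrt (complex.Re z ^+ 2 + complex.Im z ^+ 2).
Proof. by rewrite /cmod normc_def. Qed.

Lemma normC_cmod z : `|z| = ((cmod z)%:C)%C.
Proof. by rewrite normc_def cmodE. Qed.

Lemma cmod_ge0 z : 0 <= cmod z.
Proof. by rewrite cmodE sqrtr_ge0. Qed.

Lemma cmodM z w : cmod (z * w) = cmod z * cmod w.
Proof.
by apply: (@complexI R); rewrite rmorphM/= -!normC_cmod normrM.
Qed.

Lemma cmodD z w : cmod (z + w) <= cmod z + cmod w.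
Proof. by rewrite -lecR rmorphD/= -!normC_cmod ler_normD. Qed.

Lemma cmodN z : cmod (- z) = cmod z.
Proof. by rewrite /cmod normrN. Qed.

Lemma cmod0 : cmod (0 : R[i]) = 0.
Proof. by rewrite /cmod normr0. Qed.

Lemma cmod1 : cmod (1 : R[i]) = 1.
Proof. by rewrite /cmod normr1. Qed.

Lemma cmod_eq0 z : (cmod z == 0) = (z == 0).
Proof. by rewrite -[RHS]normr_eq0 normC_cmod eq_complex/= eqxx andbT. Qed.

Lemma cmod_gt0 z : (0 < cmod z) = (z != 0).
Proof. by rewrite lt_def cmod_ge0 cmod_eq0 andbT. Qed.

Lemma cmodX z k : cmod (z ^+ k) = cmod z ^+ k.
Proof. by elim: k => [|k IH]; rewrite ?cmod1// !exprS cmodM IH. Qed.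

Lemma sqr_cmod z : cmod z ^+ 2 = complex.Re z ^+ 2 + complex.Im z ^+ 2.
Proof. by rewrite cmodE sqr_sqrtr// addr_ge0// sqr_ge0. Qed.

Lemma cmod_real (x : R) : cmod (x%:C)%C = `|x|.
Proof. by rewrite cmodE/= expr0n/= addr0 sqrtr_sqr. Qed.

Lemma le_Re_cmod z : `|complex.Re z| <= cmod z.
Proof. by rewrite -sqrtr_sqr cmodE ler_wsqrtr// lerDl sqr_ge0. Qed.

Lemma le_Im_cmod z : `|complex.Im z| <= cmod z.
Proof. by rewrite -sqrtr_sqr cmodE ler_wsqrtr// lerDr sqr_ge0. Qed.

Lemma cmod_le_ReIm z : cmod z <= `|complex.Re z| + `|complex.Im z|.
Proof.
rewrite -(ger0_norm (cmod_ge0 z)) -(@ger0_norm _ (_ + _)) ?addr_ge0//.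
rewrite -ler_sqr ?nnegrE// !real_normK ?num_real// sqr_cmod sqrrD !real_normK ?num_real//.
by have := normr_ge0 (complex.Re z); have := normr_ge0 (complex.Im z); nra.
Qed.

(** Complex differentiability with real epsilon and delta. It is equivalent to
    differentiability of g as a map of normed modules over the complex field;
    the present form is the one that splits into real and imaginary parts. *)
Definition cdiff (g : R[i] -> R[i]) (z : R[i]) : Prop := exists L, forall e : R,
  0 < e -> exists2 r, 0 < r & forall h, cmod h <= r ->
    cmod (g (z + h) - g z - L * h) <= e * cmod h.

Lemma differentiable_cdiff (g : R[i]^o -> R[i]^o) (z : R[i]^o) :
  differentiable g z -> cdiff g z.
Proof.
move=> /derivable1_diffP /cvg_ex [L /cvgrPdist_le HL]; exists L => e e0.
have e0' : 0 < (e%:C)%C :> R[i] by rewrite ltcR.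
have := HL _ e0'; rewrite near_withinE => /nbhs_normP[d /= d0 Hd].
have [dE d0'] : d = ((complex.Re d)%:C)%C /\ 0 < complex.Re d.
  by move: d0; rewrite ltcE/= => /andP[/eqP i0 r0]; split => //; case: d i0 {Hd r0} => a b /= ->.
exists (complex.Re d / 2); first by rewrite divr_gt0.
move=> h hd; have [->|h0] := eqVneq h 0.
  by rewrite addr0 mulr0 subrr subr0 cmod0 mulr0.
have := Hd h; rewrite /ball_ /= sub0r normrN normC_cmod dE ltcR.
have hd' : cmod h < complex.Re d by apply: le_lt_trans hd _; lra.
move=> /(_ hd' h0); rewrite normC_cmod lecR => H.
have -> : g (z + h) - g z - L * h = - h * (L - h^-1 *: (g (h *: 1 + z) - g z)).
  have -> : h *: 1 + z = z + h by rewrite addrC /GRing.scale/= mulr1.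
  rewrite -[h^-1 *: _]/(h^-1 * (g (z + h) - g z)) mulrBr !mulNr opprK mulVKf// mulrC.
  by rewrite addrC.
by rewrite cmodM cmodN mulrC ler_wpM2r// cmod_ge0.
Qed.

Lemma cdiff_differentiable (g : R[i]^o -> R[i]^o) (z : R[i]^o) :
  cdiff g z -> differentiable g z.
Proof.
move=> [L HL]; apply/derivable1_diffP/cvg_ex; exists L; apply/cvgrPdist_le => e e0.
have [eE e0'] : e = ((complex.Re e)%:C)%C /\ 0 < complex.Re e.
  by move: e0; rewrite ltcE/= => /andP[/eqP i0 r0]; split => //; case: e i0 {r0} => a b /= ->.
have [r r0 Hr] := HL _ e0'.
rewrite near_withinE; apply/nbhs_normP; exists (r%:C)%C => /=; first by rewrite ltcR.
move=> h; rewrite /ball_ /= sub0r normrN normC_cmod ltcR => hr h0.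
rewrite normC_cmod eE lecR.
have := Hr h (ltW hr).
have -> : g (z + h) - g z - L * h = - h * (L - h^-1 *: (g (h *: 1 + z) - g z)).
  have -> : h *: 1 + z = z + h by rewrite addrC /GRing.scale/= mulr1.
  rewrite -[h^-1 *: _]/(h^-1 * (g (z + h) - g z)) mulrBr !mulNr opprK mulVKf// mulrC.
  by rewrite addrC.
by rewrite cmodM cmodN mulrC ler_pM2r// cmod_gt0.
Qed.

Lemma cdiff_near (f g : R[i] -> R[i]) z (r : R) : 0 < r ->
  (forall h, cmod h <= r -> f (z + h) = g (z + h)) -> cdiff f z -> cdiff g z.
Proof.
move=> r0 fg [L HL]; exists L => e e0; have [s s0 Hs] := HL e e0.
exists (Num.min r s); first by rewrite lt_min r0.
move=> h; rewrite le_min => /andP[hr hs].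
have := fg 0; rewrite addr0 cmod0 => <-; last exact: ltW.
by rewrite -fg//; apply: Hs.
Qed.

Definition ccont (g : R[i] -> R[i]) (z : R[i]) : Prop := forall e : R,
  0 < e -> exists2 r, 0 < r & forall h, cmod h <= r -> cmod (g (z + h) - g z) <= e.

Lemma cdiff_ccont g z : cdiff g z -> ccont g z.
Proof.
move=> [L HL] e e0; have [r r0 Hr] := HL 1 ltr01.
pose K := 1 + cmod L; have K0 : 0 < K by rewrite ltr_wpDr// cmod_ge0.
exists (Num.min r (e / K)); first by rewrite lt_min r0 divr_gt0.
move=> h; rewrite le_min => /andP[hr he].
have -> : g (z + h) - g z = (g (z + h) - g z - L * h) + L * h by rewrite subrK.
apply: le_trans (cmodD _ _) _.
apply: le_trans (lerD (Hr h hr) (lexx _)) _.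
by rewrite cmodM -mulrDl mulrC -ler_pdivlMr.
Qed.

End ComplexModulus.

(** * The maximum principle on rectangles *)

Section MaximumPrinciple.
Context {R : realType}.
Implicit Types (p q : R -> R -> R) (f g : R[i] -> R[i]).

(** A bounded form that is closed except at the origin still has zero
    circulation: away from a square of side 2e about the origin Goursat's lemma
    applies, and the circulation of the square is O(e). *)
Lemma goursat_punctured p q (a b c d B r : R) : sep_continuous p q ->
  a < 0 -> 0 < b -> c < 0 -> 0 < d ->
  (forall x y, (x, y) != (0, 0) -> closed_at p q x y) ->
  0 < r -> (forall x y, `|x| <= r -> `|y| <= r -> `|p x y| <= B /\ `|q x y| <= B) ->
  circulation p q a b c d = 0.
Proof.
move=> cpq a0 b0 c0 d0 cl r0 hB.
have B0 : 0 <= B.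
  have [||h _] := hB 0 0; rewrite ?normr0; [exact: ltW|exact: ltW|].
  exact: le_trans (normr_ge0 _) h.
have cl' (x1 x2 y1 y2 : R) : x1 <= x2 -> y1 <= y2 ->
    (0 < x1 \/ x2 < 0 \/ 0 < y1 \/ y2 < 0) -> circulation p q x1 x2 y1 y2 = 0.
  move=> hx hy h; apply: goursat => // x y /andP[? ?] /andP[? ?].
  by apply: cl; apply/negP; rewrite xpair_eqE => /andP[/eqP ? /eqP ?]; lra.
have small e : 0 < e -> e < r -> e < -a -> e < b -> e < - c -> e < d ->
    `|circulation p q a b c d| <= 8 * B * e.
  move=> e0 er ea eb ec ed.
  have -> : circulation p q a b c d = circulation p q (- e) e (- e) e.
    rewrite (@circulation_splitx _ p q a b c d (- e))//; last lra.
    rewrite (@circulation_splitx _ p q (- e) b c d e)//; last lra.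
    rewrite (@circulation_splity _ p q (- e) e c d (- e))//; last lra.
    rewrite (@circulation_splity _ p q (- e) e (- e) d e)//; last lra.
    rewrite (cl' a (- e)); [|lra|lra|lra].
    rewrite (cl' e b); [|lra|lra|lra].
    rewrite (cl' (- e) e c); [|lra|lra|lra].
    rewrite (cl' (- e) e e); [|lra|lra|lra].
    by rewrite !add0r !addr0.
  have [cp cq] := cpq.
  have cp' : continuous (fun x => p x (- e) - p x e).
    by move=> x; apply: cvgB; exact: cp.
  have cq' : continuous (fun x => q e x - q (- e) x).
    by move=> x; apply: cvgB; exact: cq.
  have ee : - e <= e by lra.
  have bp x : - e <= x <= e -> - (2 * B) <= p x (- e) - p x e <= 2 * B.
    move=> hx; have hx' : `|x| <= r by rewrite ler_norml; lra.
    have he : `|e| <= r by rewrite ler_norml; lra.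
    have he' : `|- e| <= r by rewrite normrN.
    have [] := hB x e hx' he; have [] := hB x (- e) hx' he'.
    by rewrite !ler_norml; lra.
  have bq x : - e <= x <= e -> - (2 * B) <= q e x - q (- e) x <= 2 * B.
    move=> hx; have hx' : `|x| <= r by rewrite ler_norml; lra.
    have he : `|e| <= r by rewrite ler_norml; lra.
    have he' : `|- e| <= r by rewrite normrN.
    have [] := hB e x he hx'; have [] := hB (- e) x he' hx'.
    by rewrite !ler_norml; lra.
  have u1 := segint_ub cp' ee (fun x hx => proj2 (andP (bp x hx))).
  have l1 := segint_lb cp' ee (fun x hx => proj1 (andP (bp x hx))).
  have u2 := segint_ub cq' ee (fun x hx => proj2 (andP (bq x hx))).
  have l2 := segint_lb cq' ee (fun x hx => proj1 (andP (bq x hx))).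
  by rewrite /circulation ler_norml; lra.
apply/eqP; rewrite -normr_eq0; apply/eqP/le_anti; rewrite normr_ge0 andbT.
apply/ler_addgt0Pl => e e0; rewrite addr0.
pose m := Num.min (e / (8 * B + 1)) (Num.min r (Num.min (- a) (Num.min b (Num.min (- c) d)))).
have B1 : 0 < 8 * B + 1 by lra.
have m0 : 0 < m by rewrite /m !lt_min divr_gt0//= r0 b0 d0 !oppr_gt0 a0 c0.
have : m <= m by [].
rewrite {2}/m !le_min => /andP[m1 /andP[m2 /andP[m3 /andP[m4 /andP[m5 m6]]]]].
apply: le_trans (small (m / 2) _ _ _ _ _ _) _; [lra|lra|lra|lra|lra|lra|].
by move: m1; rewrite ler_pdivlMr// => m1; nra.
Qed.

Lemma le_of_eq (x y : R) : x = y -> x <= y.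
Proof. by move->. Qed.

Lemma ReM (z w : R[i]) : complex.Re (z * w) =
  complex.Re z * complex.Re w - complex.Im z * complex.Im w.
Proof. by case: z; case: w. Qed.

Lemma ImM (z w : R[i]) : complex.Im (z * w) =
  complex.Re z * complex.Im w + complex.Im z * complex.Re w.
Proof. by case: z; case: w. Qed.

Lemma ReD (z w : R[i]) : complex.Re (z + w) = complex.Re z + complex.Re w.
Proof. by case: z; case: w. Qed.

Lemma ImD (z w : R[i]) : complex.Im (z + w) = complex.Im z + complex.Im w.
Proof. by case: z; case: w. Qed.

Lemma ReN (z : R[i]) : complex.Re (- z) = - complex.Re z.
Proof. by case: z. Qed.

Lemma ImN (z : R[i]) : complex.Im (- z) = - complex.Im z.
Proof. by case: z. Qed.

(** For g = u + iv the one-form Im (g dz) is v dx + u dy. *)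
Lemma cdiff_closed g (x y : R) : cdiff g (x +I y) ->
  closed_at (fun x y => complex.Im (g (x +I y))) (fun x y => complex.Re (g (x +I y))) x y.
Proof.
move=> [L HL]; exists (complex.Im L), (complex.Re L), (- complex.Im L) => e e0.
have [r r0 Hr] := HL e e0; exists (r / 2); first lra.
move=> x' y' hx hy.
pose h := (x' - x) +I (y' - y).
have hh : cmod h <= `|x' - x| + `|y' - y| by apply: cmod_le_ReIm.
have /Hr : cmod h <= r by lra.
have -> : x +I y + h = x' +I y' by rewrite /h; congr (_ +I _); rewrite addrC subrK.
move=> H; have H' : cmod (g (x' +I y') - g (x +I y) - L * h) <= e * (`|x' - x| + `|y' - y|).
  by apply: le_trans H _; rewrite ler_pM2l.
split.
  apply: le_trans H'; apply: le_trans (le_Im_cmod _); rewrite !ImD !ImN ImM /=.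
  by apply: le_of_eq; congr `|_|; ring.
apply: le_trans H'; apply: le_trans (le_Re_cmod _); rewrite !ReD !ReN ReM /=.
by apply: le_of_eq; congr `|_|; ring.
Qed.

Lemma ccont_sep g : (forall z, ccont g z) ->
  sep_continuous (fun x y => complex.Im (g (x +I y))) (fun x y => complex.Re (g (x +I y))).
Proof.
move=> cg; split=> t x; apply/cvgrPdist_le => e e0.
  have [r r0 Hr] := cg (x +I t) e e0.
  apply/nbhs_normP; exists r => // x' /= /ltW hr.
  have /Hr : cmod ((x' - x) +I 0) <= r by rewrite cmod_real distrC.
  have -> : x +I t + ((x' - x) +I 0) = x' +I t by congr (_ +I _); rewrite ?addr0 // addrC subrK.
  by move=> /(le_trans (le_Im_cmod _)); rewrite ImD ImN distrC.
have [r r0 Hr] := cg (t +I x) e e0.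
apply/nbhs_normP; exists r => // x' /= /ltW hr.
have /Hr : cmod (0 +I (x' - x)) <= r.
  by apply: le_trans (cmod_le_ReIm _) _; rewrite /= normr0 add0r distrC.
have -> : t +I x + (0 +I (x' - x)) = t +I x' by congr (_ +I _); rewrite ?addr0 // addrC subrK.
by move=> /(le_trans (le_Re_cmod _)); rewrite ReD ReN distrC.
Qed.

Lemma cdiffM f g z : cdiff f z -> cdiff g z -> cdiff (fun w => f w * g w) z.
Proof.
move=> /cdiff_differentiable df /cdiff_differentiable dg.
exact: differentiable_cdiff (differentiableM df dg).
Qed.

Lemma cdiff_cst (c z : R[i]) : cdiff (fun=> c) z.
Proof.
exists 0 => e e0; exists 1 => // h _.
by rewrite subrr mul0r subrr cmod0 mulr_ge0 ?cmod_ge0 ?(ltW e0).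
Qed.

Lemma cdiff_id (z : R[i]) : cdiff id z.
Proof.
exists 1 => e e0; exists 1 => // h _.
by rewrite mul1r [z + h]addrC addrK subrr cmod0 mulr_ge0 ?cmod_ge0 ?(ltW e0).
Qed.

Lemma cdiffD f g z : cdiff f z -> cdiff g z -> cdiff (fun w => f w + g w) z.
Proof.
move=> /cdiff_differentiable df /cdiff_differentiable dg.
exact: differentiable_cdiff (differentiableD df dg).
Qed.

Lemma cdiffX f z k : cdiff f z -> cdiff (fun w => f w ^+ k) z.
Proof.
move=> df; elim: k => [|k IH]; first exact: cdiff_cst.
have -> : (fun w => f w ^+ k.+1) = (fun w => f w * f w ^+ k).
  by apply/funext => w; rewrite exprS.
exact: cdiffM.
Qed.

Lemma cdiff_comp f g z : cdiff f z -> cdiff g (f z) -> cdiff (g \o f) z.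
Proof.
move=> /cdiff_differentiable df /cdiff_differentiable dg.
exact: differentiable_cdiff (differentiable_comp df dg).
Qed.

Definition diffquot g (L : R[i]) (z : R[i]) : R[i] :=
  if z == 0 then L else (g z - g 0) / z.

Lemma diffquot_cdiff g L z : cdiff g z -> z != 0 -> cdiff (diffquot g L) z.
Proof.
move=> dg z0; apply: (@cdiff_near _ (fun w => (g w - g 0) * w^-1) _ _ (cmod z / 2)).
- by rewrite divr_gt0// cmod_gt0.
- move=> h hh; rewrite /diffquot ifN//; apply/eqP => zh.
  have : cmod z = cmod h by rewrite -(cmodN h); congr cmod; apply/eqP; rewrite -addr_eq0 zh.
  by move=> e; move: hh z0; rewrite -e -cmod_gt0; lra.
apply: cdiffM; first by apply: cdiffD => //; exact: cdiff_cst.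
by apply: (@differentiable_cdiff _ GRing.inv); exact: differentiable_Rinv.
Qed.

(** Taking the derivative at 0 as the value there makes the difference quotient
    continuous, which removes the singularity of the Cauchy kernel. *)
Lemma diffquot_ccont g : (forall z, cdiff g z) ->
  exists L, forall z, ccont (diffquot g L) z.
Proof.
move=> dg; have [L HL] := dg 0; exists L => z.
have [->|z0] := eqVneq z 0; last exact/cdiff_ccont/diffquot_cdiff.
move=> e e0; have [r r0 Hr] := HL e e0; exists r => // h hr.
rewrite add0r {2}/diffquot eqxx /diffquot; case: eqVneq => [_|h0].
  by rewrite subrr cmod0 ltW.
have := Hr h hr; rewrite add0r.
have -> : g h - g 0 - L * h = ((g h - g 0) / h - L) * h by rewrite mulrBl divfK.
by rewrite cmodM ler_pM2r// cmod_gt0.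
Qed.

(** Upper bound for the imaginary part of (g - A0) dz / z along one side of a
    rectangle about 0, where [s] is the distance of the side to 0, [t] the
    position along it and [al], [be] are the parts of g up to signs: a large
    [A0] makes it negative. *)
Lemma edge_bound (s t al be A0 M D de : R) : 0 < de -> de <= s -> s <= D ->
  `|t| <= D -> `|al| <= M -> `|be| <= M -> 0 <= A0 ->
  (s * (al - A0) + t * be) / (s ^+ 2 + t ^+ 2) <=
  2 * D * M / de ^+ 2 - A0 * de / (2 * D ^+ 2).
Proof.
move=> de0 ds sD; rewrite !ler_norml => /andP[t1 t2] /andP[a1 a2] /andP[b1 b2] A00.
have M0 : 0 <= M by lra.
have D0 : 0 < D by lra.
have r0 : 0 < s ^+ 2 + t ^+ 2 by have := sqr_ge0 t; nra.
have -> : (s * (al - A0) + t * be) / (s ^+ 2 + t ^+ 2) =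
   (s * al + t * be) / (s ^+ 2 + t ^+ 2) - A0 * s / (s ^+ 2 + t ^+ 2) by field; lra.
apply: lerB.
  apply: (@le_trans _ _ (2 * D * M / (s ^+ 2 + t ^+ 2))).
    rewrite ler_pM2r ?invr_gt0//; nra.
  apply: ler_wpM2l; first by nra.
  by rewrite lef_pV2 ?posrE ?exprn_gt0//; have := sqr_ge0 t; nra.
apply: ler_pM.
- by rewrite mulr_ge0// ltW.
- by rewrite invr_ge0; nra.
- by nra.
by rewrite lef_pV2 ?posrE//; nra.
Qed.

(** A Cauchy estimate with an inexplicit constant. The form Im ((g - g 0) dz / z)
    has zero circulation, but by [edge_bound] it would be negative on every
    side if g 0 were positive and too large compared with g on the boundary.
    The constant depends on the rectangle alone, which is all that is needed to
    pass to the sharp bound. *)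
Lemma crude_bound (a b c d : R) : a < 0 -> 0 < b -> c < 0 -> 0 < d ->
  exists C : R, forall g, (forall z, cdiff g z) -> forall M,
   (forall x y, a <= x <= b -> c <= y <= d ->
      (x == a) || (x == b) || (y == c) || (y == d) -> cmod (g (x +I y)) <= M) ->
   complex.Im (g 0) = 0 -> complex.Re (g 0) <= C * M.
Proof.
move=> a0 b0 c0 d0.
pose D := (b - a) + (d - c); pose de := Num.min (- a) (Num.min b (Num.min (- c) d)).
have de0 : 0 < de by rewrite /de !lt_min b0 d0 !oppr_gt0 a0 c0.
have : de <= de by [].
rewrite {2}/de !le_min => /andP[dea /andP[deb /andP[dec ded]]].
have D0 : 0 < D by rewrite /D; lra.
exists (4 * (D / de) ^+ 3) => g dg M hM Im0.
have M0 : 0 <= M.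
  by apply: le_trans (hM a c _ _ _); rewrite ?cmod_ge0 ?lexx ?eqxx//=; lra.
have [h0|h0] := ltP (complex.Re (g 0)) 0.
  apply: le_trans (ltW h0) _.
  by rewrite mulr_ge0// mulr_ge0// exprn_ge0// divr_ge0// ltW.
have [L cL] := diffquot_ccont dg.
pose G := diffquot g L.
pose p x y := complex.Im (G (x +I y)); pose q x y := complex.Re (G (x +I y)).
have cpq : sep_continuous p q by apply: ccont_sep.
have cl x y : (x, y) != (0, 0) -> closed_at p q x y.
  move=> xy; apply: cdiff_closed; apply: diffquot_cdiff => //.
  by rewrite eq_complex/= -xpair_eqE.
have [r r0 Hr] := cL 0 1 ltr01.
pose A0 := complex.Re (g 0).
have K0 : circulation p q a b c d = 0.
  apply: (@goursat_punctured _ _ _ _ _ _ (cmod L + 1) (r / 2)) => //; first lra.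
  move=> x y hx hy.
  have : cmod (x +I y) <= r by apply: le_trans (cmod_le_ReIm _) _; rewrite /=; lra.
  move=> /Hr; rewrite add0r {2}/diffquot eqxx => h.
  have hG : cmod (G (x +I y)) <= cmod L + 1.
    rewrite -[G _](subrK L) addrC; apply: le_trans (cmodD _ _) _.
    by rewrite lerD2l.
  by split; apply: le_trans hG; [exact: le_Im_cmod|exact: le_Re_cmod].
have GE x y : x +I y != 0 ->
    p x y = (x * complex.Im (g (x +I y)) - y * (complex.Re (g (x +I y)) - A0))
              / (x ^+ 2 + y ^+ 2) /\
    q x y = (x * (complex.Re (g (x +I y)) - A0) + y * complex.Im (g (x +I y)))
              / (x ^+ 2 + y ^+ 2).
  move=> z0; rewrite /p /q /G /diffquot (negbTE z0) ImM ReM !ImD !ReD !ImN !ReN Im0 /= -/A0.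
  by split; ring.
pose kap := 2 * D * M / de ^+ 2 - A0 * de / (2 * D ^+ 2).
have kap_ge0 : 0 <= kap.
  have ab : a <= b by lra.
  have cd : c <= d by lra.
  have nz (x y : R) : x != 0 \/ y != 0 -> x +I y != 0.
    by move=> h; rewrite eq_complex/= negb_and; apply/orP.
  have [a0' b0'] : a != 0 /\ b != 0 by rewrite lt_eqF// gt_eqF.
  have [c0' d0'] : c != 0 /\ d != 0 by rewrite lt_eqF// gt_eqF.
  have bp x : a <= x <= b -> p x c - p x d <= kap + kap.
    move=> hx; apply: lerD.
      have [-> _] := GE x c (nz _ _ (or_intror c0')).
      have hg := hM x c hx; rewrite lexx cd eqxx !orbT/= in hg; have {}hg := hg isT isT.
      have := @edge_bound (- c) x (complex.Re (g (x +I c))) (complex.Im (g (x +I c))) A0 M D de.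
      rewrite sqrrN [c ^+ 2 + _]addrC => H; apply: le_trans (H _ _ _ _ _ _ _) => //.
      - by apply: le_of_eq; congr (_ / _); ring.
      - by rewrite /D; lra.
      - by rewrite ler_norml /D; lra.
      - exact: le_trans (le_Re_cmod _) hg.
      - exact: le_trans (le_Im_cmod _) hg.
    have [-> _] := GE x d (nz _ _ (or_intror d0')).
    have hg := hM x d hx; rewrite lexx cd eqxx !orbT/= in hg; have {}hg := hg isT isT.
    have := @edge_bound d (- x) (complex.Re (g (x +I d))) (complex.Im (g (x +I d))) A0 M D de.
    rewrite sqrrN [d ^+ 2 + _]addrC => H; apply: le_trans (H _ _ _ _ _ _ _) => //.
    - by rewrite -[X in X <= _]mulNr; apply: le_of_eq; congr (_ / _); ring.
    - by rewrite /D; lra.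
    - by rewrite normrN ler_norml /D; lra.
    - exact: le_trans (le_Re_cmod _) hg.
    - exact: le_trans (le_Im_cmod _) hg.
  have bq y : c <= y <= d -> q b y - q a y <= kap + kap.
    move=> hy; apply: lerD.
      have [_ ->] := GE b y (nz _ _ (or_introl b0')).
      have hg := hM b y; rewrite lexx ab eqxx ?orbT/= in hg; have {}hg := hg isT hy isT.
      apply: edge_bound => //.
      - by rewrite /D; lra.
      - by rewrite ler_norml /D; lra.
      - exact: le_trans (le_Re_cmod _) hg.
      - exact: le_trans (le_Im_cmod _) hg.
    have [_ ->] := GE a y (nz _ _ (or_introl a0')).
    have hg := hM a y; rewrite lexx ab eqxx ?orbT/= in hg; have {}hg := hg isT hy isT.
    have := @edge_bound (- a) (- y) (complex.Re (g (a +I y))) (complex.Im (g (a +I y))) A0 M D de.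
    rewrite !sqrrN => H; apply: le_trans (H _ _ _ _ _ _ _) => //.
    - by rewrite -[X in X <= _]mulNr; apply: le_of_eq; congr (_ / _); ring.
    - by rewrite /D; lra.
    - by rewrite normrN ler_norml /D; lra.
    - exact: le_trans (le_Re_cmod _) hg.
    - exact: le_trans (le_Im_cmod _) hg.
  have [cp cq] := cpq.
  have cp' : continuous (fun x => p x c - p x d).
    by move=> x; apply: cvgB; exact: cp.
  have cq' : continuous (fun x => q b x - q a x).
    by move=> x; apply: cvgB; exact: cq.
  have u1 := segint_ub cp' ab bp.
  have u2 := segint_ub cq' cd bq.
  have : 0 <= (kap + kap) * (b - a) + (kap + kap) * (d - c).
    by rewrite -K0 /circulation lerD.
  rewrite -mulrDr -/D => h; rewrite leNgt; apply/negP => k0; nra.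
move: kap_ge0; rewrite /kap subr_ge0 ler_pdivrMr ?mulr_gt0 ?exprn_gt0//.
have -> : 2 * D * M / de ^+ 2 * (2 * D ^+ 2) = 4 * (D / de) ^+ 3 * M * de.
  by field; rewrite gt_eqF.
by rewrite ler_pM2r.
Qed.

Lemma le1_of_bounded_powers (x C : R) : (forall k, x ^+ k <= C) -> x <= 1.
Proof.
move=> h; rewrite leNgt; apply/negP => x1.
have B k : 1 + k%:R * (x - 1) <= x ^+ k.
  elim: k => [|k IH]; first by rewrite mul0r addr0.
  have k0 : (0 : R) <= k%:R by [].
  have x0 : 0 <= x by lra.
  apply: le_trans (_ : x * (1 + k%:R * (x - 1)) <= _); last by rewrite exprS ler_wpM2l.
  have := mulr_ge0 k0 (sqr_ge0 (x - 1)); rewrite -natr1; move: (k%:R) => t; lra.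
have d0 : 0 < x - 1 by lra.
pose k := (Num.truncn (C / (x - 1))).+1.
have hk : C / (x - 1) < k%:R by rewrite /k truncnS_gt.
have := le_trans (B k) (h k); move: hk; rewrite ltr_pdivrMr//; lra.
Qed.

(** Landau's trick: the crude estimate applies to all powers of g with the same
    constant, so the constant disappears on taking roots. Multiplying [g ^+ k]
    by the conjugate of its value at the centre makes that value real. *)
Theorem maximum_principle g (a b c d x0 y0 M : R) : (forall z, cdiff g z) ->
  a < x0 < b -> c < y0 < d -> 0 < M ->
  (forall x y, a <= x <= b -> c <= y <= d ->
    (x == a) || (x == b) || (y == c) || (y == d) -> cmod (g (x +I y)) <= M) ->
  cmod (g (x0 +I y0)) <= M.
Proof.
move=> dg /andP[ax xb] /andP[cy yd] M0 hM.
pose w0 := x0 +I y0; pose g0 := g w0.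
have [||||C HC] := @crude_bound (a - x0) (b - x0) (c - y0) (d - y0); [lra|lra|lra|lra|].
have [g00|g00] := eqVneq (cmod g0) 0; first by rewrite -/w0 -/g0 g00 ltW.
have gp : 0 < cmod g0 by rewrite lt_def g00 cmod_ge0.
have key k : (cmod g0 / M) ^+ k <= C.
  (* f 0 = |g0| ^ (2 k) is real, as crude_bound requires. *)
  pose f w := g (w + w0) ^+ k * (conjc g0) ^+ k.
  have df z : cdiff f z.
    apply: cdiffM; last exact: cdiff_cst.
    apply: cdiffX; apply: (@cdiff_comp (fun w => w + w0) g) => //.
    by apply: cdiffD; [exact: cdiff_id|exact: cdiff_cst].
  have cJ : cmod (conjc g0) = cmod g0.
    by rewrite !cmodE; case: (g0) => u v /=; rewrite sqrrN.
  have f0 : f 0 = ((cmod g0 ^+ 2) ^+ k)%:C%C.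
    rewrite /f add0r -/g0 -exprMn rmorphXn/=; congr (_ ^+ _).
    by rewrite -sqr_normc normC_cmod rmorphXn.
  have := HC f df ((M * cmod g0) ^+ k).
  rewrite f0 /= => /(_ _ (erefl _)); rewrite exprMn => H.
  have := H _; rewrite expr2 exprMn mulrA.
  rewrite ler_pM2r ?exprn_gt0// => {}H.
  rewrite expr_div_n ler_pdivrMr ?exprn_gt0//; apply: H => x y hx hy hb.
  rewrite /f cmodM !cmodX cJ ler_pM2r ?exprn_gt0//.
  apply: lerXn2r; rewrite ?nnegrE ?cmod_ge0 ?(ltW M0)//.
  have -> : x +I y + w0 = (x + x0) +I (y + y0) by [].
  apply: hM; [lra|lra|].
  by move: hb => /orP[/orP[/orP[]|]|] /eqP ->; rewrite subrK eqxx ?orbT.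
have := le1_of_bounded_powers key.
by rewrite ler_pdivrMr// mul1r.
Qed.

End MaximumPrinciple.

(** * The complex exponential and the three lines theorem *)

Section ComplexExponential.
Context {R : realType}.
Implicit Types (z w : R[i]).
Definition cexp z : R[i] :=
  (expR (complex.Re z) * cos (complex.Im z)) +I (expR (complex.Re z) * sin (complex.Im z)).

Lemma cmod_cexp z : cmod (cexp z) = expR (complex.Re z).
Proof.
by rewrite cmodE /= !exprMn -mulrDr cos2Dsin2 mulr1 sqrtr_sqr ger0_norm// expR_ge0.
Qed.

Lemma cexpD z w : cexp (z + w) = cexp z * cexp w.
Proof.
case: z w => [a b] [c d]; rewrite /cexp/= expRD cosD sinD.
by congr (_ +I _); ring.
Qed.

Lemma derive0_estimate (f : R -> R) (l : R) : is_derive (0 : R) 1 f l ->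
  forall e, 0 < e -> exists2 r, 0 < r & forall h, `|h| <= r ->
    `|f h - f 0 - l * h| <= e * `|h|.
Proof.
move=> [df dl] e e0.
have /cvgrPdist_le H : (fun h => h^-1 *: (f (h *: 1 + 0) - f 0)) @ 0^' --> l.
  by rewrite -dl.
have := H _ e0; rewrite near_withinE => /nbhs_normP[d /= d0 Hd].
exists (d / 2); first by rewrite divr_gt0.
move=> h hd; have [->|h0] := eqVneq h 0.
  by rewrite mulr0 subrr subr0 normr0 mulr0.
have := Hd h; rewrite /ball_ /= sub0r normrN => /(_ _ h0).
have hd' : `|h| < d by apply: le_lt_trans hd _; lra.
move=> /(_ hd') {}H.
have -> : f h - f 0 - l * h = - h * (l - h^-1 *: (f (h *: 1 + 0) - f 0)).
  by rewrite addr0 /GRing.scale/= mulr1; field.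
by rewrite normrM normrN mulrC ler_wpM2r.
Qed.

Lemma cexp_estimate0 (e : R) : 0 < e -> exists2 r, 0 < r & forall h : R[i],
  cmod h <= r -> cmod (cexp h - 1 - h) <= e * cmod h.
Proof.
move=> e0.
have [k k0 [ke k1]] : exists2 k : R, 0 < k & k <= e / 9 /\ k <= 1.
  exists (Num.min (e / 9) 1); first by rewrite lt_min divr_gt0//= ltr01.
  by rewrite !ge_min !lexx orbT.
have [r1 r10 H1] := derive0_estimate (is_derive_expR (0 : R)) k0.
have [r2 r20 H2] := derive0_estimate (is_derive_sin (0 : R)) k0.
have [r3 r30 H3] := derive0_estimate (is_derive_cos (0 : R)) k0.
exists (Num.min k (Num.min r1 (Num.min r2 r3))); first by rewrite !lt_min k0 r10 r20.
move=> h; rewrite !le_min => /andP[hk /andP[h1 /andP[h2 h3]]].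
set a := complex.Re h; set b := complex.Im h; set N := cmod h.
have N0 : 0 <= N by exact: cmod_ge0.
have aN : `|a| <= N by exact: le_Re_cmod.
have bN : `|b| <= N by exact: le_Im_cmod.
have kN (t : R) : `|t| <= N -> k * `|t| <= k * N by move=> ?; rewrite ler_pM2l.
have A := le_trans (H1 a (le_trans aN h1)) (kN a aN).
have B := le_trans (H2 b (le_trans bN h2)) (kN b bN).
have C := le_trans (H3 b (le_trans bN h3)) (kN b bN).
move: A B C; rewrite expR0 sin0 cos0 oppr0 mul0r !subr0 ?addr0 !mul1r => A B C.
have E1 : `|expR a - 1| <= 2 * N.
  have -> : expR a - 1 = (expR a - 1 - a) + a by rewrite subrK.
  apply: le_trans (ler_normD _ _) _; apply: le_trans (lerD A aN) _; nra.
have E2 : `|expR a| <= 3.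
  have -> : expR a = (expR a - 1) + 1 by rewrite subrK.
  apply: le_trans (ler_normD _ _) _; rewrite normr1; move: hk E1; rewrite -/N; lra.
apply: le_trans (cmod_le_ReIm _) _.
have -> : complex.Re (cexp h - 1 - h) = (expR a - 1 - a) + expR a * (cos b - 1).
  by rewrite !ReD !ReN /= -/a -/b; ring.
have -> : complex.Im (cexp h - 1 - h) = expR a * (sin b - b) + (expR a - 1) * b.
  by rewrite !ImD !ImN /= -/a -/b; ring.
have F1 : `|expR a * (cos b - 1)| <= 3 * (k * N) by rewrite normrM ler_pM.
have F2 : `|expR a * (sin b - b)| <= 3 * (k * N).
  by rewrite normrM ler_pM.
have F3 : `|(expR a - 1) * b| <= 2 * N * k.
  by rewrite normrM ler_pM//; apply: le_trans bN hk.
apply: le_trans (lerD (ler_normD _ _) (ler_normD _ _)) _.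
have : 9 * (k * N) <= e * N by rewrite mulrA ler_wpM2r//; lra.
by move: A F1 F2 F3; lra.
Qed.

Lemma cdiff_cexp z : cdiff cexp z.
Proof.
exists (cexp z) => e e0; have m0 : 0 < cmod (cexp z) by rewrite cmod_cexp expR_gt0.
have [r r0 Hr] := cexp_estimate0 (divr_gt0 e0 m0); exists r => // h hr.
have -> : cexp (z + h) - cexp z - cexp z * h = cexp z * (cexp h - 1 - h).
  by rewrite cexpD; ring.
by rewrite cmodM mulrC -ler_pdivlMr// mulrAC; apply: Hr.
Qed.

(** The factor [cexp (u z)] levels the two boundary bounds to 1 and, through
    e (z ^ 2 - 1), decays on far horizontal sides. So the maximum principle on
    a tall rectangle bounds the product by 1, and e may tend to 0. *)
Theorem three_lines (g : R[i] -> R[i]) (m0 m1 B t : R) : (forall z, cdiff g z) ->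
  (forall x y, 0 <= x <= 1 -> cmod (g (x +I y)) <= B) ->
  (forall y, cmod (g (0 +I y)) <= expR m0) ->
  (forall y, cmod (g (1 +I y)) <= expR m1) ->
  0 <= t <= 1 -> cmod (g (t +I 0)) <= expR ((1 - t) * m0 + t * m1).
Proof.
move=> dg hB h0 h1 /andP[t0 t1].
have [->|t0'] := eqVneq t 0; first by rewrite mul0r subr0 mul1r addr0.
have [->|t1'] := eqVneq t 1; first by rewrite subrr mul0r mul1r add0r.
have tt : 0 < t < 1 by rewrite lt_def t0' t0 lt_def eq_sym t1' t1.
have [->|g0] := eqVneq (cmod (g (t +I 0))) 0; first exact: expR_ge0.
have gp : 0 < cmod (g (t +I 0)) by rewrite lt_def g0 cmod_ge0.
rewrite -[leLHS]lnK ?posrE// ler_expR; apply/ler_addgt0Pl => e e0.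
pose u z := - (m0%:C%C + (m1 - m0)%:C%C * z) + e%:C%C * (z * z - 1).
pose f z := g z * cexp (u z).
have df z : cdiff f z.
  apply: cdiffM => //; apply: (@cdiff_comp _ u cexp); last exact: cdiff_cexp.
  have -> : u = fun z => (- m0%:C%C + (- (m1 - m0)%:C%C) * z) + e%:C%C * (z * z + - 1).
    by apply/funext => w; rewrite /u; ring.
  by do ![exact: cdiff_cst|exact: cdiff_id|apply: cdiffD|apply: cdiffM].
have uE x y : complex.Re (u (x +I y)) =
    - (m0 + (m1 - m0) * x) + e * (x ^+ 2 - y ^+ 2 - 1).
  by rewrite /u; simpc => /=; ring.
(* Since B <= exp |B|, the exponent K dominates all that grows on the side
   y = T, and T >= 1 gives e T ^ 2 >= e T >= K. *)
pose K := `|m0| + `|m1| + `|B|; pose T := K / e + 1.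
have K0 : 0 <= K by rewrite /K !addr_ge0.
have T1 : 1 <= T by rewrite /T lerDr divr_ge0// ltW.
have TK : K <= e * (T * T).
  have : K / e <= T * T by apply: le_trans (_ : T <= _); rewrite ?/T; [lra|rewrite -/T; nra].
  by rewrite ler_pdivrMr// mulrC.
have := @maximum_principle _ f 0 1 (- T) T t 0 1 df tt _ ltr01.
have -> : - T < 0 < T by lra.
move=> /(_ isT) H.
have {H} : cmod (f (t +I 0)) <= 1.
  apply: H => x y hx hy; rewrite /f cmodM cmod_cexp uE => hb.
  have side : [\/ x = 0, x = 1 | y ^+ 2 = T * T].
    case/orP: hb => [/orP[/orP[]|]|] /eqP ->.
    - exact: Or31.
    - exact: Or32.
    - by apply: Or33; rewrite sqrrN expr2.
    - by apply: Or33; rewrite expr2.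
  rewrite -ler_pdivlMr ?expR_gt0// mul1r -expRN.
  have y2 := sqr_ge0 y.
  case: side => ->.
  - by apply: le_trans (h0 y) _; rewrite ler_expR; nra.
  - by apply: le_trans (h1 y) _; rewrite ler_expR; nra.
  apply: le_trans (hB x y hx) _; apply: le_trans (ler_norm B) _.
  apply: le_trans (_ : expR `|B| <= _).
    by apply: le_trans (expR_ge1Dx _); rewrite lerDr.
  rewrite ler_expR.
  have n0 := ler_norm m0; have n1 := ler_norm m1.
  have n0' := ler_norm (- m0); have n1' := ler_norm (- m1); rewrite !normrN in n0' n1'.
  have : - (m0 + (m1 - m0) * x) <= `|m0| + `|m1|.
    have -> : - (m0 + (m1 - m0) * x) = (1 - x) * (- m0) + x * (- m1) by ring.
    case/andP: hx => x0 x1; apply: lerD.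
      by apply: le_trans (_ : (1 - x) * `|m0| <= _); [apply: ler_wpM2l => //; lra|nra].
    by apply: le_trans (_ : x * `|m1| <= _); [apply: ler_wpM2l|rewrite ler_piMl].
  have : e * (x ^+ 2 - 1) <= 0.
    by rewrite pmulr_rle0// subr_le0 expr_le1//; case/andP: hx.
  by move: TK; rewrite /K; nra.
rewrite /f cmodM cmod_cexp uE -ler_pdivlMr ?expR_gt0// mul1r -expRN.
move=> h; have := h; rewrite -{1}[X in X <= _]lnK ?posrE// ler_expR => {}h.
by apply: le_trans h _; nra.
Qed.

End ComplexExponential.

(** * Subgradients and affine minorants of the logarithm of a holomorphic function *)

Section Dotv.
Context {R : realType} {n : nat}.
Implicit Types (x y z : 'rV[R]_n).

Lemma dotvC x y : dotv x y = dotv y x.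
Proof. by apply: eq_bigr => j _; rewrite mulrC. Qed.

Lemma dotvDr x y z : dotv x (y + z) = dotv x y + dotv x z.
Proof. by rewrite -big_split; apply: eq_bigr => j _; rewrite mxE mulrDr. Qed.

Lemma dotvZr x (a : R) y : dotv x (a *: y) = a * dotv x y.
Proof. by rewrite mulr_sumr; apply: eq_bigr => j _; rewrite mxE mulrCA. Qed.

Lemma dotvDl x y z : dotv (y + z) x = dotv y x + dotv z x.
Proof. by rewrite !(dotvC _ x) dotvDr. Qed.

Lemma dotvZl x (a : R) y : dotv (a *: y) x = a * dotv y x.
Proof. by rewrite !(dotvC _ x) dotvZr. Qed.

Lemma dotv_delta x k : dotv x (delta_mx 0 k) = x 0 k.
Proof.
rewrite /dotv (bigD1 k)//= mxE !eqxx mulr1 big1 ?addr0// => j jk.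
by rewrite mxE (negbTE jk) andbF mulr0.
Qed.

Lemma dotvBr x y z : dotv x (y - z) = dotv x y - dotv x z.
Proof. by rewrite -scaleN1r dotvDr dotvZr mulN1r. Qed.

End Dotv.

Section Subgradient.
Context {R : realType} {n : nat}.
Implicit Types (s t u v : 'rV[R]_n) (h : 'rV[R]_n -> R).

Definition convex_fun h : Prop := forall s t (a : R), 0 <= a <= 1 ->
  h ((1 - a) *: s + a *: t) <= (1 - a) * h s + a * h t.

(** One-dimensional extension as in the Hahn-Banach theorem: an affine minorant
    on the span of the first k basis vectors extends to the next one, the
    admissible slopes forming the interval between the left and the right
    difference quotients, which convexity keeps in order. *)
Lemma subgradient_step h s0 (al : 'rV[R]_n) (k : 'I_n) : convex_fun h ->
  (forall t, (forall j : 'I_n, (k <= j)%N -> t 0 j = 0) -> h s0 + dotv al t <= h (s0 + t)) ->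
  exists al', forall t, (forall j : 'I_n, (k < j)%N -> t 0 j = 0) ->
    h s0 + dotv al' t <= h (s0 + t).
Proof.
move=> ch Hal; pose e : 'rV[R]_n := delta_mx 0 k.
pose W : set 'rV[R]_n := [set t | forall j : 'I_n, (k <= j)%N -> t 0 j = 0].
(* A left quotient never exceeds a right one: compare on the segment joining
   s0 + v - b e to s0 + u + a e, at the point whose e-coordinate is that of s0. *)
have cross u v (a b : R) : W u -> W v -> 0 < a -> 0 < b ->
    (h s0 + dotv al v - h (s0 + v - b *: e)) / b <=
    (h (s0 + u + a *: e) - h s0 - dotv al u) / a.
  move=> Wu Wv a0 b0; pose tau := a / (a + b).
  have ab : 0 < a + b by rewrite addr_gt0.
  have tau01 : 0 <= tau <= 1.
    by rewrite /tau divr_ge0 ?(ltW a0) ?(ltW ab)//= ler_pdivrMr// mul1r lerDl ltW.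
  have := ch (s0 + u + a *: e) (s0 + v - b *: e) tau tau01.
  have -> : (1 - tau) *: (s0 + u + a *: e) + tau *: (s0 + v - b *: e) =
      s0 + (a + b)^-1 *: (b *: u + a *: v).
    apply/rowP => j; rewrite !mxE /tau; field; lra.
  have Wuv : W ((a + b)^-1 *: (b *: u + a *: v)).
    by move=> j kj; rewrite !mxE Wu// Wv// !mulr0 addr0 mulr0.
  have := Hal _ Wuv; rewrite dotvZr dotvDr !dotvZr => h1 h2.
  have h3 := le_trans h1 h2.
  rewrite ler_pdivrMr// mulrAC ler_pdivlMr//.
  have E1 : 1 - tau = b / (a + b) by rewrite /tau; field; lra.
  have E2 : (a + b) * ((a + b)^-1 * (b * dotv al u + a * dotv al v)) =
      b * dotv al u + a * dotv al v by rewrite mulVKf ?gt_eqF.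
  have E3 z1 z2 : (a + b) * (b / (a + b) * z1 + a / (a + b) * z2) = b * z1 + a * z2.
    by field; lra.
  by move: h3; rewrite E1 /tau -(ler_pM2l ab) mulrDr E2 E3; lra.
pose L : set R := [set x | exists v b, [/\ W v, 0 < b &
  x = (h s0 + dotv al v - h (s0 + v - b *: e)) / b]].
have W0 : W 0 by move=> j _; rewrite mxE.
have L0 : L !=set0 by exists ((h s0 + dotv al 0 - h (s0 + 0 - 1 *: e)) / 1), 0, 1.
have Lub u (a : R) : W u -> 0 < a ->
    ubound L ((h (s0 + u + a *: e) - h s0 - dotv al u) / a).
  by move=> Wu a0 _ [v [b [Wv b0 ->]]]; apply: cross.
pose c := sup L.
have cup u (a : R) : W u -> 0 < a -> c * a <= h (s0 + u + a *: e) - h s0 - dotv al u.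
  by move=> Wu a0; rewrite -ler_pdivlMr//; apply: ge_sup => //; exact: Lub.
have clo v (b : R) : W v -> 0 < b -> h s0 + dotv al v - h (s0 + v - b *: e) <= c * b.
  move=> Wv b0; rewrite -ler_pdivrMr//; apply: ub_le_sup; last by exists v, b.
  by exists ((h (s0 + 0 + 1 *: e) - h s0 - dotv al 0) / 1); exact: Lub.
exists (al + (c - al 0 k) *: e) => t Ht.
pose u := t - t 0 k *: e.
have Wu : W u.
  move=> j; rewrite leq_eqVlt !mxE => /orP[/eqP/val_inj <-|kj].
    by rewrite !eqxx mulr1 subrr.
  rewrite (Ht j kj) (_ : _ && _ = false) ?mulr0 ?subr0//.
  by apply/negP => /andP[_ /eqP jk]; rewrite jk ltnn in kj.
have tE : t = u + t 0 k *: e by rewrite subrK.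
have dE : dotv (al + (c - al 0 k) *: e) t = dotv al u + c * t 0 k.
  rewrite dotvDl dotvZl [dotv e t]dotvC dotv_delta {1}tE dotvDr dotvZr dotv_delta.
  by ring.
rewrite dE; have [tk|tk|tk] := ltrgtP (t 0 k) 0.
- have := clo u (- t 0 k) Wu; rewrite oppr_gt0 => /(_ tk).
  by rewrite scaleNr opprK -[s0 + u + _]addrA -tE; lra.
- by have := cup u (t 0 k) Wu tk; rewrite -[s0 + u + _]addrA -tE; lra.
- have -> : s0 + t = s0 + u by rewrite tE tk scale0r addr0.
  by rewrite tk mulr0 addr0; exact: Hal.
Qed.

Theorem subgradient_exists h s0 : convex_fun h ->
  exists al, forall t, h s0 + dotv al (t - s0) <= h t.
Proof.
move=> ch.
have H k : (k <= n)%N -> exists al, forall t,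
    (forall j : 'I_n, (k <= j)%N -> t 0 j = 0) -> h s0 + dotv al t <= h (s0 + t).
  elim: k => [_|k IH kn].
    exists 0 => t ht; have -> : t = 0 by apply/rowP => j; rewrite ht// mxE.
    by rewrite /dotv big1 ?addr0// => j _; rewrite mxE mul0r.
  have [al Hal] := IH (ltnW kn).
  exact: (@subgradient_step h s0 al (Ordinal kn)).
have [al Hal] := H n (leqnn n).
exists al => t; have := Hal (t - s0); rewrite [s0 + _]addrC subrK; apply.
by move=> j; rewrite leqNgt ltn_ord.
Qed.

End Subgradient.

Section AffineMinorant.
Context {R : realType} {n : nat}.
Local Notation Cn := 'rV[R[i]]_n.

Definition re_vec (w : Cn) : 'rV[R]_n := map_mx (@complex.Re R) w.

Definition real_vec (d : 'rV[R]_n) : Cn := map_mx (fun x : R => (x%:C)%C) d.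

(** Let M(s) be the supremum of |F| on the fibre re_vec w = s. The three lines
    theorem on the complex lines with real direction t - s says that ln M is
    convex, and ln M <= psi; so a subgradient of ln M is an affine minorant of
    psi that touches ln M at the given point. Replacing M by its maximum with
    exp lb keeps the logarithm finite and preserves convexity, because the
    constant lb lies below psi. *)
Theorem affine_minorant (F : Cn -> R[i]) (psi : 'rV[R]_n -> R) (lb : R) :
  (forall w d z, cdiff (fun z => F (w + z *: real_vec d)) z) ->
  (forall w, cmod (F w) <= expR (psi (re_vec w))) ->
  (forall s, lb <= psi s) ->
  (forall s t, exists B, forall a : R, 0 <= a <= 1 -> psi ((1 - a) *: s + a *: t) <= B) ->
  forall w, exists al c, (forall s, dotv al s + c <= psi s) /\
    cmod (F w) <= expR (dotv al (re_vec w) + c).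
Proof.
move=> dF hF hlb hB w.
pose A s : set R := [set cmod (F w) | w in [set w | re_vec w = s]].
have revC s : re_vec (real_vec s) = s by apply/rowP => j; rewrite !mxE.
have A0 s : A s !=set0 by exists (cmod (F (real_vec s))); exists (real_vec s) => //; apply: revC.
have Aub s : ubound (A s) (expR (psi s)) by move=> _ [v /= <- <-]; apply: hF.
pose m s := Num.max (expR lb) (sup (A s)).
have m_gt0 s : 0 < m s by rewrite lt_max expR_gt0.
pose h s := ln (m s).
have hE s : expR (h s) = m s by rewrite lnK ?posrE.
have Fh v : cmod (F v) <= expR (h (re_vec v)).
  rewrite hE le_max; apply/orP; right; apply: ub_le_sup; last by exists v.
  by exists (expR (psi (re_vec v))).
have h_psi s : h s <= psi s.
  rewrite -ler_expR hE ge_max ler_expR hlb /=.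
  by apply: ge_sup => //; exact: Aub.
have lb_h s : lb <= h s by rewrite -ler_expR hE le_max lexx.
have ch : convex_fun h.
  move=> s t a a01; rewrite -ler_expR hE ge_max; apply/andP; split.
    by rewrite ler_expR; case/andP: a01 => ? ?; have := lb_h s; have := lb_h t; nra.
  apply: ge_sup => // _ [v /= vE <-].
  (* The line w + z (t - s) is shifted to meet the given point at z = a. *)
  pose v0 := v - real_vec (a *: (t - s)).
  pose g z := F (v0 + z *: real_vec (t - s)).
  have gre x y : re_vec (v0 + (x +I y) *: real_vec (t - s)) = (1 - x) *: s + x *: t.
    apply/rowP => j; move/rowP: vE => /(_ j); rewrite !mxE !ReD ReN ReM /= => ->.
    by ring.
  have [B HB] := hB s t.
  have -> : F v = g (a +I 0).
    congr F; rewrite /v0; apply/rowP => j; rewrite !mxE rmorphM/= -/(real_complex _ a).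
    by rewrite subrK.
  apply: (@three_lines _ g _ _ (expR B)) => //.
  - by move=> z; apply: dF.
  - move=> x y hx; apply: le_trans (hF _) _; rewrite gre ler_expR.
    exact: HB.
  - by move=> y; apply: le_trans (Fh _) _; rewrite gre subr0 scale1r scale0r addr0.
  - by move=> y; apply: le_trans (Fh _) _; rewrite gre subrr scale1r scale0r add0r.
have [al Hal] := subgradient_exists (re_vec w) ch.
exists al, (h (re_vec w) - dotv al (re_vec w)); split.
  by move=> s; apply: le_trans (h_psi s); have := Hal s; rewrite dotvBr; lra.
by rewrite addrC subrK.
Qed.

End AffineMinorant.

(** * The biconjugate and the comparison of inductive limits *)

Section Biconjugate.
Context {R : realType} {n : nat}.
Implicit Types (g : 'rV[R]_n -> R) (x y s t : 'rV[R]_n).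

Lemma classA_mono g x y : classA g -> orthant x -> (forall j, x 0 j <= y 0 j) -> g x <= g y.
Proof.
move=> [_ _ mono _] ox xy.
have oy : orthant y by move=> j; apply: le_trans (ox j) (xy j).
pose u k : 'rV[R]_n := \row_j (if (j < k)%N then y 0 j else x 0 j).
have ou k : orthant (u k) by move=> j; rewrite mxE; case: ifP => _; [exact: oy|exact: ox].
have H k : (k <= n)%N -> g x <= g (u k).
  elim: k => [_|k IH kn].
    by apply: le_of_eq; congr g; apply/rowP => j; rewrite mxE.
  apply: le_trans (IH (ltnW kn)) _; apply: (mono _ _ (Ordinal kn)) => //.
    move=> j jk; rewrite !mxE ltnS [(j <= k)%N]leq_eqVlt.
    by rewrite -val_eqE/= in jk; rewrite (negbTE jk).
  by rewrite !mxE /= ltnn ltnSn.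
have -> : y = u n by apply/rowP => j; rewrite mxE ltn_ord.
exact: H.
Qed.

Lemma classA_ge0 g x : classA g -> g 0 <= g x.
Proof.
move=> Ag; have [_ sym _ _] := Ag; rewrite (sym x); apply: classA_mono => //.
  by move=> j; rewrite mxE.
by move=> j; rewrite !mxE.
Qed.

Lemma psi_biconj_le g t : (psi_biconj g t <= (psi g t)%:E)%E.
Proof.
apply: ge_ereal_sup => _ [y _ <-].
have h : ((dotv t y)%:E - (psi g t)%:E <= young_fenchel (fun x => (psi g x)%:E) y)%E.
  by apply: ereal_sup_ubound; exists t => //; rewrite dotvC.
move: h; case: (young_fenchel _ y) => [r| |] /=.
- by rewrite -EFinB !lee_fin; lra.
- by rewrite leNye.
- by rewrite -EFinB leeNy_eq.
Qed.

Lemma psi_biconj_ge g (al t : 'rV[R]_n) (c : R) :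
  (forall s, dotv al s + c <= psi g s) -> ((dotv al t + c)%:E <= psi_biconj g t)%E.
Proof.
move=> H.
have h : (young_fenchel (fun x => (psi g x)%:E) al <= (- c)%:E)%E.
  apply: ge_ereal_sup => _ [y _ <-]; rewrite -EFinB lee_fin.
  by have := H y; lra.
apply: le_trans (_ : ((dotv t al)%:E - young_fenchel (fun x => (psi g x)%:E) al <= _)%E).
  by move: h; case: (young_fenchel _ al) => [r| |] //=; rewrite ?leey// -EFinB !lee_fin dotvC; lra.
by apply: ereal_sup_ubound; exists al.
Qed.

Definition psi_biconj_fin g t : R := fine (psi_biconj g t).

(** The zero slope gives the constant g 0 as an affine minorant, so the
    biconjugate never takes the value -oo; it is at most psi, so it never takes
    the value +oo. *)
Lemma psi_biconjE g t : classA g -> psi_biconj g t = (psi_biconj_fin g t)%:E.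
Proof.
move=> Ag; rewrite /psi_biconj_fin fineK// fin_numElt; apply/andP; split; last first.
  by apply: le_lt_trans (psi_biconj_le _ _) (ltry _).
apply: lt_le_trans (@psi_biconj_ge g 0 t (g 0) _); first exact: ltNyr.
move=> s; rewrite /dotv big1 ?add0r => [|j _]; last by rewrite mxE mul0r.
exact: classA_ge0.
Qed.

End Biconjugate.

Section InductiveLimits.
Context {R : realType} {n : nat}.
Local Notation Cn := 'rV[R[i]]_n.
Local Notation fct := (Cn -> R[i]^o).
Implicit Types (f : fct) (w : Cn -> \bar R) (W : nat -> Cn -> \bar R).

Lemma wnorm_leP w (u : Cn -> R) m f (P : R) : (forall z, w z = (u z)%:E) ->
  (wnorm w m f <= P%:E)%E <->
  forall z, cmod (f z) * (1 + cnorm z) ^+ m <= P * expR (u z).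
Proof.
move=> wu.
have E z : ((cmod (f z) * (1 + cnorm z) ^+ m)%:E / expeR (w z))%E =
    (cmod (f z) * (1 + cnorm z) ^+ m / expR (u z))%:E.
  by rewrite wu /= inver gt_eqF ?expR_gt0// -EFinM.
split=> H.
  move=> z; rewrite -ler_pdivrMr ?expR_gt0// -lee_fin -E.
  by apply: le_trans H; apply: ereal_sup_ubound; exists z.
apply: ge_ereal_sup => _ [z _ <-]; rewrite E lee_fin ler_pdivrMr ?expR_gt0//.
Qed.

(** Continuity of the inclusion of the step of weight w in the step of weight
    w', the m-th norm being controlled by the norm with the same index. *)
Definition dominates w w' : Prop := forall m, exists2 C : R, 0 < C &
  forall f P, entire f -> 0 < P -> (wnorm w m f <= P%:E)%E -> (wnorm w' m f <= (C * P)%:E)%E.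

Lemma dominates_wspace w w' : dominates w w' -> wspace w `<=` wspace w'.
Proof.
move=> D f [ef hf]; split=> // m; have [C C0 HC] := D m.
have [P P0 hP] : exists2 P : R, 0 < P & (wnorm w m f <= P%:E)%E.
  move: (hf m); case: (wnorm w m f) => [r| |]//= _.
    by exists (Num.max r 1); rewrite ?lt_max ?ltr01 ?orbT// lee_fin le_max lexx.
  by exists 1; rewrite ?ltr01 ?leNye.
exact: le_lt_trans (HC f P ef P0 hP) (ltry _).
Qed.

(** The trace of V on the smaller step is a neighbourhood of 0 there: finitely
    many norms are involved, so the domination constants have a common bound. *)
Lemma dominates_nbhs0 w w' V : dominates w w' -> wspace_nbhs0 w' V -> wspace_nbhs0 w V.
Proof.
move=> D [M [e [e0 HV]]].
have /choice[C HC] : forall m, exists c : R, 0 < c /\ forall f P, entire f -> 0 < P ->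
    (wnorm w m f <= P%:E)%E -> (wnorm w' m f <= (c * P)%:E)%E.
  by move=> m; have [c c0 hc] := D m; exists c.
pose K := 1 + \sum_(m < M.+1) C m.
have K0 : 0 < K by rewrite ltr_wpDr ?sumr_ge0// => i _; case: (HC i) => /ltW.
exists M, (e / K); split; first by rewrite divr_gt0.
move=> f wf hf; apply: HV; first exact: dominates_wspace wf.
move=> m mM; have [C0 H] := HC m.
apply: le_lt_trans (H f (e / K) (proj1 wf) (divr_gt0 e0 K0) (ltW (hf m mM))) _.
rewrite lte_fin mulrCA -ltr_pdivlMl// mulVf ?gt_eqF// ltr_pdivrMr// mul1r /K.
rewrite (bigD1 (Ordinal (mM : (m < M.+1)%N)))//=.
have : 0 <= \sum_(i < M.+1 | i != Ordinal (mM : (m < M.+1)%N)) C i.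
  by apply: sumr_ge0 => i _; case: (HC i) => /ltW.
lra.
Qed.

Lemma indlim_sub W W' : (forall nu, exists mu, dominates (W nu) (W' mu)) ->
  indlim W `<=` indlim W'.
Proof.
move=> D f [nu _ hf]; have [mu hmu] := D nu; exists mu => //.
exact: dominates_wspace hf.
Qed.

Lemma indlim_open_sub W W' : (forall nu, exists mu, dominates (W nu) (W' mu)) ->
  (forall nu, exists mu, dominates (W' nu) (W mu)) ->
  indlim_open W `<=` indlim_open W'.
Proof.
move=> D D' U [UW HU]; split; first exact: subset_trans UW (indlim_sub D).
move=> f Uf; have [V [VW Vc Vn VU]] := HU f Uf; exists V; split => //.
  exact: subset_trans VW (indlim_sub D).
by move=> nu; have [mu hmu] := D' nu; exact: dominates_nbhs0 hmu (Vn mu).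
Qed.

End InductiveLimits.

(** * Comparison of the two weights *)

Section WeightComparison.
Context {R : realType} {n : nat}.
Local Notation Cn := 'rV[R[i]]_n.
Local Notation fct := (Cn -> R[i]^o).
Implicit Types (g : 'rV[R]_n -> R) (f : fct) (z : Cn).

Lemma psi_log1p g (y : 'rV[R]_n) :
  psi g (map_mx (fun t => ln (1 + `|t|)) y) = g (map_mx (fun t => 1 + `|t|) y).
Proof.
rewrite /psi; congr g; apply/rowP => j; rewrite !mxE lnK// posrE.
by rewrite ltr_wpDr.
Qed.

(** The biconjugate is at most psi, whose value at the point ln (1 + |y|) is
    g (1 + |y|); the shift by 1 in every coordinate costs the constant K. *)
Lemma weightH_dominates_weightE g g' (K : R) : classA g -> classA g' ->
  (forall x xi, orthant x -> unit_cube xi -> g (x + xi) <= g' x + K) ->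
  dominates (weightH g) (weightE g').
Proof.
move=> Ag Ag' HK m; exists (expR K); first exact: expR_gt0.
move=> f P _ P0 /(wnorm_leP _ _ _ (fun z => psi_biconjE _ Ag)) H.
apply/(wnorm_leP _ _ _ (fun z => erefl)) => z.
apply: le_trans (H z) _; rewrite [expR K * P]mulrC -mulrA ler_pM2l// -expRD ler_expR.
have [_ sym _ _] := Ag'.
apply: (@le_trans _ _ (g (map_mx Num.norm (imv z) + const_mx 1))).
  rewrite -lee_fin -psi_biconjE//; apply: le_trans (psi_biconj_le _ _) _.
  rewrite psi_log1p lee_fin; apply: le_of_eq; congr g.
  by apply/rowP => j; rewrite !mxE addrC.
rewrite [K + _]addrC /weightE (sym (imv z)); apply: HK => j; first by rewrite mxE.
by rewrite mxE ler01 lexx.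
Qed.

Lemma le_coord_enorm (x : 'rV[R]_n) j : `|x 0 j| <= enorm x.
Proof.
rewrite -sqrtr_sqr; apply: ler_wsqrtr; rewrite (bigD1 j)//= lerDl.
by apply: sumr_ge0 => k _; rewrite sqr_ge0.
Qed.

Lemma le_coord_cnorm z j : cmod (z 0 j) <= cnorm z.
Proof.
rewrite -[leLHS]ger0_norm ?cmod_ge0// -sqrtr_sqr; apply: ler_wsqrtr.
rewrite (bigD1 j)//= lerDl.
by apply: sumr_ge0 => k _; rewrite sqr_ge0.
Qed.

Lemma enorm_ge0 (x : 'rV[R]_n) : 0 <= enorm x.
Proof. exact: sqrtr_ge0. Qed.

Lemma cnorm_ge0 z : 0 <= cnorm z.
Proof. exact: sqrtr_ge0. Qed.

Lemma sum_sqr_le (I : finType) (a : I -> R) : (forall i, 0 <= a i) ->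
  \sum_i a i ^+ 2 <= (\sum_i a i) ^+ 2.
Proof.
move=> a0; rewrite [leRHS]expr2 mulr_suml; apply: ler_sum => i _.
rewrite expr2; apply: ler_wpM2l => //; rewrite (bigD1 i)//= lerDl.
exact: sumr_ge0.
Qed.

Lemma cnorm_le_sum z : cnorm z <= \sum_j cmod (z 0 j).
Proof.
have s0 : 0 <= \sum_j cmod (z 0 j) by apply: sumr_ge0 => j _; exact: cmod_ge0.
rewrite -(ger0_norm s0) -sqrtr_sqr; apply: ler_wsqrtr; apply: sum_sqr_le => j.
exact: cmod_ge0.
Qed.

Lemma prod_1D_ge (I : finType) (a : I -> R) : (forall i, 0 <= a i) ->
  1 + \sum_i a i <= \prod_i (1 + a i).
Proof.
move=> a0; suff [] : 1 + \sum_i a i <= \prod_i (1 + a i) /\ 0 <= \sum_i a i by [].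
elim/big_rec2: _ => [|i p s _ [h1 h2]]; first by rewrite addr0.
by have := a0 i; split; nra.
Qed.

Lemma Re_sum (I : finType) (a : I -> R[i]) :
  complex.Re (\sum_i a i) = \sum_i complex.Re (a i).
Proof. by elim/big_rec2: _ => [//|i x y _ <-]; rewrite ReD. Qed.

Lemma polar_cexp (r y : R) : 0 < r -> `|y| <= r -> exists th,
  r * sin th = y.
Proof.
move=> r0; rewrite ler_norml => /andP[y1 y2]; exists (asin (y / r)).
have h : y / r \in `[(-1), 1].
  by rewrite in_itv/=; apply/andP; split; rewrite ?ler_pdivlMr ?ler_pdivrMr// ?mulN1r ?mul1r.
by rewrite asinK// mulrC divfK// gt_eqF.
Qed.

(** The function f in exponential coordinates centred at the real point x. The
    factor cexp (m sum w) has modulus (prod r_j) ^ m when the polyradius is r;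
    it carries the polynomial weight along the imaginary directions. The scalar
    [lam] is a normalisation. *)
Definition exp_lift f (x : 'rV[R]_n) (m : nat) (lam : R) (w : Cn) : R[i] :=
  (lam%:C)%C * f (real_vec x + map_mx cexp w) * cexp (m%:R * \sum_j w 0 j).

Lemma exp_lift_cdiff f (x : 'rV[R]_n) m lam (w : Cn) (d : 'rV[R]_n) (z : R[i]) : entire f ->
  cdiff (fun z : R[i] => exp_lift f x m lam (w + z *: real_vec d)) z.
Proof.
move=> ef; apply: cdiffM; first (apply: cdiffM; first exact: cdiff_cst).
  pose ze (z : R[i]^o) : Cn := real_vec x +
    \sum_(j < n) (cexp (w 0 j + z * (d 0 j)%:C%C) : R[i]^o) *: (delta_mx 0 j : Cn).
  have -> : (fun z : R[i] => f (real_vec x + map_mx cexp (w + z *: real_vec d))) = f \o ze.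
    apply/funext => u /=; congr (f (_ + _)).
    rewrite [LHS]row_sum_delta; apply: eq_bigr => j _; congr (_ *: _).
    by rewrite !mxE.
  apply: differentiable_cdiff; apply: differentiable_comp; last exact: ef.
  apply: differentiableD; first exact: differentiable_cst.
  have -> : (fun z : R[i]^o => \sum_(j < n) (cexp (w 0 j + z * (d 0 j)%:C%C) : R[i]^o) *: (delta_mx 0 j : Cn)) =
     \sum_(j < n) (fun z : R[i]^o => (cexp (w 0 j + z * (d 0 j)%:C%C) : R[i]^o) *: (delta_mx 0 j : Cn)).
    by apply/funext => u; rewrite fct_sumE.
  apply: differentiable_sum => j; apply: differentiableZl.
  apply: (@cdiff_differentiable _ (fun z : R[i] => cexp (w 0 j + z * (d 0 j)%:C%C))).
  apply: (@cdiff_comp _ (fun z : R[i] => w 0 j + z * (d 0 j)%:C%C) cexp); last exact: cdiff_cexp.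
  by do ![exact: cdiff_cst|exact: cdiff_id|apply: cdiffD|apply: cdiffM].
apply: (@cdiff_comp _ (fun z : R[i] => m%:R * \sum_j (w + z *: real_vec d) 0 j) cexp); last exact: cdiff_cexp.
have -> : (fun z : R[i] => m%:R * \sum_j (w + z *: real_vec d) 0 j) =
   fun z : R[i] => m%:R * (\sum_j w 0 j + z * \sum_j (d 0 j)%:C%C).
  apply/funext => u; congr (_ * _); rewrite mulr_sumr -big_split; apply: eq_bigr => j _.
  by rewrite !mxE.
by do ![exact: cdiff_cst|exact: cdiff_id|apply: cdiffD|apply: cdiffM].
Qed.

(** Let r be the polyradius exp (re_vec w). On the torus of polyradius r about x
    the imaginary parts are at most r in modulus, so f is controlled by g r.
    Moving the weight from the point of the torus to its centre costs
    (1 + |r|) ^ m, and the factor (prod r_j) ^ m costs (1 + |r|) ^ (n m); the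
    growth condition between g and g' absorbs both. *)
Lemma exp_lift_bound g g' (C0 P : R) f (m : nat) (x : 'rV[R]_n) : classA g ->
  (forall y, g y + (m + n * m).+1%:R * ln (1 + enorm y) <= g' y + C0) -> 0 < P ->
  (forall z, cmod (f z) * (1 + cnorm z) ^+ m <= P * expR (g (imv z))) ->
  forall w : Cn, cmod (f (real_vec x + map_mx cexp w)) *
      (1 + \sum_j `|x 0 j|) ^+ m * expR (m%:R * \sum_j re_vec w 0 j) <=
    P * n.+1%:R ^+ m * expR C0 * expR (psi g' (re_vec w)).
Proof.
move=> Ag HC P0 H w.
set ze := real_vec x + _; set rho := map_mx expR (re_vec w).
have E0 := enorm_ge0 rho; have N0 := cnorm_ge0 ze.
have rho0 j : 0 < rho 0 j by rewrite mxE expR_gt0.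
have zeE j : ze 0 j = (x 0 j)%:C%C + cexp (w 0 j) by rewrite !mxE.
have rhoE j : rho 0 j = cmod (cexp (w 0 j)) by rewrite cmod_cexp !mxE.
have im_le : g (imv ze) <= g rho.
  have [_ sym _ _] := Ag; rewrite (sym (imv ze)); apply: classA_mono => //.
    by move=> j; rewrite mxE.
  move=> j; rewrite rhoE !mxE ImD -/(real_complex _ _).
  by rewrite (_ : complex.Im (_%:C)%C = 0)// add0r; exact: le_Im_cmod.
have S_le : 1 + \sum_j `|x 0 j| <= n.+1%:R * ((1 + cnorm ze) * (1 + enorm rho)).
  have : \sum_j `|x 0 j| <= \sum_(j < n) ((1 + cnorm ze) * (1 + enorm rho)).
    apply: ler_sum => j _.
    have -> : `|x 0 j| = cmod (ze 0 j - cexp (w 0 j)) by rewrite zeE addrK cmod_real.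
    apply: le_trans (cmodD _ _) _; rewrite cmodN -rhoE.
    have h1 := le_coord_cnorm ze j; have h2 := le_trans (ler_norm _) (le_coord_enorm rho j).
    by have := mulr_ge0 N0 E0; lra.
  rewrite sumr_const card_ord -mulr_natl -natr1 mulrDl mul1r.
  by have := mulr_ge0 N0 E0; lra.
have prod_le : expR (\sum_j re_vec w 0 j) <= (1 + enorm rho) ^+ n.
  rewrite expR_sum; apply: le_trans (_ : \prod_(j < n) (1 + enorm rho) <= _).
    apply: ler_prod => j _; rewrite expR_ge0 /=.
    have := le_trans (ler_norm _) (le_coord_enorm rho j); rewrite mxE => h.
    by apply: le_trans h _; rewrite lerDr.
  by rewrite prodr_const card_ord.
have S0 : 0 <= 1 + \sum_j `|x 0 j| by rewrite addr_ge0// sumr_ge0.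
have e1 : (1 + \sum_j `|x 0 j|) ^+ m <=
    n.+1%:R ^+ m * ((1 + cnorm ze) ^+ m * (1 + enorm rho) ^+ m).
  rewrite -!exprMn; apply: lerXn2r => //; rewrite nnegrE.
  by apply: le_trans S0 S_le.
have e2 : expR (m%:R * \sum_j re_vec w 0 j) <= (1 + enorm rho) ^+ (n * m).
  by rewrite mulrC expRM_natr exprM; apply: lerXn2r; rewrite ?nnegrE ?expR_ge0 ?exprn_ge0 ?addr_ge0.
have f0 := cmod_ge0 (f ze).
apply: (@le_trans _ _ ((cmod (f ze) * (1 + cnorm ze) ^+ m) * n.+1%:R ^+ m *
   ((1 + enorm rho) ^+ m * (1 + enorm rho) ^+ (n * m)))).
  rewrite -[leLHS]mulrA -!mulrA ler_wpM2l//.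
  apply: le_trans (ler_pM _ _ e1 e2) _; rewrite ?exprn_ge0 ?expR_ge0//.
  by apply: le_of_eq; ring.
have -> : P * n.+1%:R ^+ m * expR C0 * expR (psi g' (re_vec w)) =
   P * expR (g' rho + C0) * n.+1%:R ^+ m by rewrite expRD /psi -/rho; ring.
rewrite [leLHS]mulrAC ler_wpM2r ?exprn_ge0//.
apply: le_trans (_ : P * expR (g rho) * (1 + enorm rho) ^+ (m + n * m) <= _).
  rewrite exprD ler_wpM2r ?mulr_ge0 ?exprn_ge0 ?addr_ge0//.
  by apply: le_trans (H ze) _; rewrite ler_pM2l// ler_expR.
rewrite -mulrA ler_pM2l//.
have Ep : 0 < 1 + enorm rho by rewrite ltr_wpDr.
rewrite -[X in X ^+ _](lnK Ep) -expRM_natl -expRD ler_expR.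
apply: le_trans (HC rho); rewrite lerD2l ler_wpM2r ?ler_nat//.
by rewrite ln_ge0// lerDl.
Qed.

Lemma psi_segment_bound g (s t : 'rV[R]_n) : classA g ->
  exists B, forall a : R, 0 <= a <= 1 -> psi g ((1 - a) *: s + a *: t) <= B.
Proof.
move=> Ag; exists (g (\row_j expR (Num.max (s 0 j) (t 0 j)))) => a /andP[a0 a1].
rewrite /psi; apply: classA_mono => // j; rewrite !mxE ?expR_ge0// ler_expR.
have h1 : s 0 j <= Num.max (s 0 j) (t 0 j) by rewrite le_max lexx.
have h2 : t 0 j <= Num.max (s 0 j) (t 0 j) by rewrite le_max lexx orbT.
by move: (Num.max _ _) h1 h2 => M h1 h2; nra.
Qed.

(** For z with imaginary part y put r_j = 1 + |y_j| and choose the real point x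
    such that z lies on the torus of polyradius r about x. In the exponential
    coordinates centred at x the point z sits at real part ln r, which is where
    the weight evaluates the biconjugate, and [affine_minorant] replaces the
    bound by psi with a bound by its biconjugate. Since r_j >= 1, the factor
    1 + |z| is at most a constant times (1 + sum |x_j|) prod r_j, so the
    polynomial weight is recovered from the centre and the exponential factor. *)
Lemma weightE_dominates_weightH g g' : classA g -> classA g' ->
  (forall A, 0 < A -> exists C : R, 0 < C /\
     forall x, g x + A * ln (1 + enorm x) <= g' x + C) ->
  dominates (weightE g) (weightH g').
Proof.
move=> Ag Ag' HA m.
have [C0 [_ HC]] := HA (m + n * m).+1%:R (ltr0Sn _ _).
exists ((2 ^+ n) ^+ m * (n.+1%:R ^+ m * expR C0)).
  by rewrite !mulr_gt0 ?exprn_gt0 ?expR_gt0.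
move=> f P ef P0 /(wnorm_leP _ _ _ (fun z => erefl)) H.
apply/(wnorm_leP _ _ _ (fun z => psi_biconjE _ Ag')) => z.
set t := map_mx _ (imv z).
pose r j := 1 + `|imv z 0 j|.
have r1 j : 1 <= r j by rewrite lerDl.
have r0 j : 0 < r j by apply: lt_le_trans (r1 j).
have tE j : expR (t 0 j) = r j by rewrite mxE lnK ?posrE//; exact: r0.
have /choice[th Hth] : forall j, exists th, r j * sin th = imv z 0 j.
  by move=> j; apply: polar_cexp => //; rewrite lerDr.
(* With r_j sin th_j = y_j, z_j - x_j = r_j exp (i th_j). *)
pose x : 'rV[R]_n := \row_j (complex.Re (z 0 j) - r j * cos (th j)).
pose w : Cn := \row_j (t 0 j +I th j).
have rw : re_vec w = t by apply/rowP => j; rewrite !mxE.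
have zE : real_vec x + map_mx cexp w = z.
  apply/rowP => j.
  have -> : (real_vec x + map_mx cexp w) 0 j = (x 0 j)%:C%C + cexp (w 0 j) by rewrite !mxE.
  have -> : w 0 j = (t 0 j +I th j) by rewrite mxE.
  rewrite /cexp /= tE Hth !mxE.
  by case: (z 0 j) => a b; apply/eqP; rewrite eq_complex/= subrK add0r !eqxx.
pose S := 1 + \sum_j `|x 0 j|.
have S0 : 0 < S by rewrite ltr_wpDr// sumr_ge0.
pose K := P * n.+1%:R ^+ m * expR C0.
have K0 : 0 < K by rewrite !mulr_gt0 ?exprn_gt0 ?expR_gt0.
pose lam := S ^+ m / K.
have lam0 : 0 < lam by rewrite divr_gt0// exprn_gt0.
have cF v : cmod (exp_lift f x m lam v) =
    cmod (f (real_vec x + map_mx cexp v)) * S ^+ m * expR (m%:R * \sum_j re_vec v 0 j) / K.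
  rewrite /exp_lift !cmodM cmod_real ger0_norm ?ltW// cmod_cexp.
  have -> : complex.Re (m%:R * \sum_j v 0 j) = m%:R * \sum_j re_vec v 0 j.
    have -> : (m%:R : R[i]) = ((m%:R : R)%:C)%C by rewrite rmorph_nat.
    rewrite ReM (_ : complex.Im (_%:C)%C = 0)// mul0r subr0.
    by rewrite Re_sum; congr (_ * _); apply: eq_bigr => j _; rewrite mxE.
  by rewrite /lam; ring.
have hF v : cmod (exp_lift f x m lam v) <= expR (psi g' (re_vec v)).
  by rewrite cF ler_pdivrMr// [leRHS]mulrC; exact: (exp_lift_bound x Ag HC P0 H).
have [al [c [Hmin Hw]]] := affine_minorant
  (fun v d u => exp_lift_cdiff x m lam v d u ef) hF
  (fun s => classA_ge0 _ Ag') (fun s u => psi_segment_bound s u Ag') w.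
have {}Hw : cmod (exp_lift f x m lam w) <= expR (psi_biconj_fin g' t).
  apply: le_trans Hw _; rewrite ler_expR -lee_fin -psi_biconjE// rw.
  exact: psi_biconj_ge.
move: Hw; rewrite cF zE rw ler_pdivrMr// => Hw.
have et : expR (\sum_j t 0 j) = \prod_j r j.
  by rewrite expR_sum; apply: eq_bigr => j _; rewrite tE.
have cn : 1 + cnorm z <= S * (2 ^+ n * expR (\sum_j t 0 j)).
  have c1 : cnorm z <= \sum_j `|x 0 j| + \sum_j r j.
    apply: le_trans (cnorm_le_sum z) _; rewrite -big_split; apply: ler_sum => j _.
    have -> : z 0 j = (x 0 j)%:C%C + cexp (w 0 j) by rewrite -{1}zE !mxE.
    apply: le_trans (cmodD _ _) _; rewrite cmod_real cmod_cexp.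
    have -> : complex.Re (w 0 j) = t 0 j by rewrite -rw [RHS]mxE.
    by rewrite tE.
  have c2 : 1 + \sum_j r j <= 2 ^+ n * \prod_j r j.
    apply: le_trans (prod_1D_ge (fun j => ltW (r0 j))) _.
    rewrite -[n in 2 ^+ n]card_ord -prodr_const -big_split /=.
    by apply: ler_prod => j _; have := r1 j; lra.
  rewrite et; apply: le_trans (_ : S * (1 + \sum_j r j) <= _); last by rewrite ler_pM2l.
  have : 0 <= \sum_j r j by apply: sumr_ge0 => j _; exact: ltW.
  have : 0 <= \sum_j `|x 0 j| by apply: sumr_ge0.
  by rewrite /S; nra.
have cnm : (1 + cnorm z) ^+ m <= S ^+ m * ((2 ^+ n) ^+ m * expR (m%:R * \sum_j t 0 j)).
  rewrite mulrC [m%:R * _]mulrC expRM_natr -!exprMn [_ * S]mulrC.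
  apply: lerXn2r => //; rewrite nnegrE; first by rewrite addr_ge0 ?cnorm_ge0.
  by rewrite !mulr_ge0 ?exprn_ge0 ?expR_ge0 ?ltW.
apply: le_trans (ler_wpM2l (cmod_ge0 _) cnm) _.
have -> : cmod (f z) * (S ^+ m * ((2 ^+ n) ^+ m * expR (m%:R * \sum_j t 0 j))) =
  (2 ^+ n) ^+ m * (cmod (f z) * S ^+ m * expR (m%:R * \sum_j t 0 j)) by ring.
have -> : (2 ^+ n) ^+ m * (n.+1%:R ^+ m * expR C0) * P * expR (psi_biconj_fin g' t) =
  (2 ^+ n) ^+ m * (expR (psi_biconj_fin g' t) * K) by rewrite /K; ring.
by rewrite ler_pM2l ?exprn_gt0.
Qed.

End WeightComparison.

(** * The two inductive limits coincide *)

(** Both comparisons raise the index by one; mutually dominating steps have the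
    same union and the same finest locally convex topology. *)
Theorem proposition2 (R : realType) (n : nat) (n_gt0 : (0 < n)%N)
  (phi : nat -> 'rV[R]_n -> R)
  (phiA : forall nu, classA (phi nu))
  (i0 : forall nu (A : R), 0 < A -> exists C : R, 0 < C /\
     forall x, phi nu x + A * ln (1 + enorm x) <= phi nu.+1 x + C)
  (i1 : forall nu, exists sigma gamma : R, [/\ 1 < sigma, 0 < gamma &
     forall x, phi nu (sigma *: x) <= phi nu.+1 x + gamma])
  (i2 : forall nu, exists K : R, 0 < K /\
     forall x xi, orthant x -> unit_cube xi ->
       phi nu (x + xi) <= phi nu.+1 x + K) :
  E_Phi phi = H_Phi phi /\ E_Phi_open phi = H_Phi_open phi.
Proof.
have EH nu : exists mu, dominates (weightE (phi nu)) (weightH (phi mu)).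
  by exists nu.+1; apply: weightE_dominates_weightH => //; exact: i0.
have HE nu : exists mu, dominates (weightH (phi nu)) (weightE (phi mu)).
  have [K [_ HK]] := i2 nu; exists nu.+1.
  exact: weightH_dominates_weightE HK.
split; apply/seteqP; split.
- exact: indlim_sub.
- exact: indlim_sub.
- exact: indlim_open_sub.
- exact: indlim_open_sub.
Qed.
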